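(* Assume that $$\mathbb{E}\Big[\sum_{i\in\mathbb{N}_+} y_i^{(0)}(\xi)\big(\log^+ y_i^{(0)}(\xi)\big)^2\Big]<\infty,$$ $$-\infty<\mathbb{E}\Big[\sum_{i\in\mathbb{N}_+} y_i^{(0)}(\xi)\log y_i^{(0)}(\xi)\Big]<0,$$ and $$\mathbb{E}\Big[\Big(\sum_{i\in\mathbb{N}_+} y_i^{(0)}(\xi)\Big)\Big|\log\Big(\sum_{i\in\mathbb{N}_+} y_i^{(0)}(\xi)\Big)\Big|\Big]=\infty .$$ Then the functional equation $$\phi(\xi,u)=E_\xi\Big[\prod_{i\in\mathbb{N}_+}\phi\big(T\xi,u\,y_i^{(0)}(\xi)\big)\Big]\quad\text{for all }u\ge 0\text{ and }\tau\text{-a.e. }\xi$$ has no solution $\phi$ in $\mathcal{L}_1$.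
   Context: Environment. $\mathbb{N}=\{0,1,2,\dots\}$, $\mathbb{N}_+=\{1,2,\dots\}$. The random environment $\xi=(\xi_n)_{n\in\mathbb{N}}$ is an i.i.d. sequence with values in a measurable space $(\Theta,\mathcal{E})$; $\tau$ denotes its law on $(\Theta^{\mathbb{N}},\mathcal{E}^{\otimes\mathbb{N}})$. $T$ is the shift: $T(\xi_0,\xi_1,\dots)=(\xi_1,\xi_2,\dots)$. To each value of $\xi_n$ corresponds (measurably) a distribution $\eta(\xi_n)$ on sequences of non-negative numbers that are ultimately zero. Given $\xi$, for each $n$ the random sequence $\bar Y^{(n)}=(y_1^{(n)}(\xi),y_2^{(n)}(\xi),\dots)$ has law $\eta(\xi_n)$ (so the law of $y^{(0)}_i(\xi)$, $i\in\mathbb{N}_+$, depends only on $\xi_0$). $P_\xi$, $E_\xi$ denote the quenched probability and expectation (given $\xi$). $\mathbb{P}$ is the annealed law, $\int g\,d\mathbb{P}=\int_{\Theta^{\mathbb{N}}}\big(\int g(\xi,y)\,dP_\xi(y)\big)d\tau(\xi)$ for positive measurable $g$, with expectation $\mathbb{E}$. Convention: $0\log 0=0$. Standing assumption: for each $n\in\mathbb{N}$ and $\tau$-a.e. $\xi$, $$E_\xi\Big[\sum_{i\in\mathbb{N}_+}y_i^{(n)}(\xi)\Big]=1,\qquad P_\xi\Big[\sum_{i\in\mathbb{N}_+}\mathbf{1}_{\{y_i^{(n)}(\xi)>0\}}<\infty\Big]=1,\qquad \mathbb{E}\log\Big[E_\xi\sum_{i\in\mathbb{N}_+}\mathbf{1}_{\{y_i^{(n)}(\xi)>0\}}\Big]>0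 .$$ Class $\mathcal{L}_c$ ($c>0$): the set of functions $\phi(\xi,u)=\int_{[0,\infty)}e^{-ux}\mu_\xi(dx)$, $u\ge 0$, $\xi\in\Theta^{\mathbb{N}}$, where $(\mu_\xi)_{\xi}$ is a (measurable in $\xi$) family of probability distributions on $[0,\infty)$ with $\mathbb{E}\int x\,\mu_\xi(dx)=c$. *)

(* Defs.v *)
From HB Require Import structures.
From mathcomp Require Import all_boot all_order all_algebra.
From mathcomp Require Import finmap.
From mathcomp Require Import all_classical all_reals all_analysis.

Set Implicit Arguments.
Unset Strict Implicit.
Unset Printing Implicit Defensive.

Import Order.TTheory GRing.Theory Num.Theory.
Import numFieldNormedType.Exports.

Local Open Scope classical_set_scope.
Local Open Scope ring_scope.

Definition coordinate_preimages d (T : measurableType d) : set (set (nat -> T)) :=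
  [set C | exists n (A : set T), measurable A /\ C = [set x | A (x n)]].
Arguments coordinate_preimages {d} T _.

(* T^nat with its product sigma-algebra. *)
Definition seqspace d (T : measurableType d) : Type :=
  g_sigma_algebraType (coordinate_preimages T).

HB.instance Definition _ d (T : measurableType d) :=
  Measurable.on (seqspace T).

Definition env_shift d (T : measurableType d) (x : seqspace T) : seqspace T :=
  fun n => x n.+1.

(* The coordinates are i.i.d. under tau: they all have the law of the 0-th one,
   and every finite subfamily of them is independent. *)
Definition iid d (T : measurableType d) (R : realType)
    (tau : probability (seqspace T) R) : Prop :=
  (forall (n : nat) (A : set T), measurable A ->
    tau [set x | A (x n)] = tau [set x | A (x 0%N)]) /\
  (forall (J : {fset nat}) (A : nat -> set T),
    (forall n, measurable (A n)) ->
    tau [set x | forall n, n \in J -> A n (x n)] =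
    (\prod_(n <- J) tau [set x | A n (x n)])%E).

Definition nonneg_ultimately_zero (R : realType) : set (seqspace R) :=
  [set y | (forall i, 0 <= y i) /\ exists N, forall i, (N <= i)%N -> y i = 0].
Arguments nonneg_ultimately_zero R _ : clear implicits.

Section annealed.
Context d d' (X : measurableType d) (W : measurableType d') (R : realType).
Variables (tau : probability X R) (P : R.-pker X ~> W).

Definition annealed (A : set (X * W)) : \bar R :=
  (\int[tau]_x \int[P x]_w (\1_A (x, w))%:E)%E.

Let annealedE : annealed =
  mkproduct (kprobability (measurable_cst (tau : pprobability X R)))
            (kernel.kernel_snd P) tt.
Proof. by []. Qed.

Let annealed0 : annealed set0 = 0%E.
Proof. by rewrite annealedE measure0. Qed.

Let annealed_ge0 A : (0 <= annealed A)%E.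
Proof. by rewrite annealedE measure_ge0. Qed.

Let annealed_sigma_additive : semi_sigma_additive annealed.
Proof. rewrite annealedE; exact: measure_semi_sigma_additive. Qed.

HB.instance Definition _ := isMeasure.Build _ _ _ annealed
  annealed0 annealed_ge0 annealed_sigma_additive.

Let annealed_setT : annealed [set: X * W] = 1%:E.
Proof.
transitivity (\int[tau]_x (cst 1%E x))%E; last first.
  by rewrite integral_cst// mul1e; exact: probability_setT.
apply: eq_integral => x _.
transitivity (\int[P x]_w (cst 1%E w))%E; last first.
  by rewrite integral_cst// mul1e; exact: prob_kernel.
by apply: eq_integral => w _; rewrite indicT.
Qed.

HB.instance Definition _ :=
  Measure_isProbability.Build _ _ _ annealed annealed_setT.

End annealed.

(* The random sequences are given on an arbitrary measurable space W carrying
   the quenched laws P xi; the sequence with number n is the measurable map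
   (xi, w) |-> Y n (xi, w), its indices starting from 0. *)
Section model.
Context d d' (Theta : measurableType d) (W : measurableType d') (R : realType).
Variables (tau : probability (seqspace Theta) R)
  (P : R.-pker (seqspace Theta) ~> W)
  (Y : nat -> {mfun (seqspace Theta * W)%type >-> seqspace R}).

Definition quenched_law (eta : R.-pker Theta ~> seqspace R) : Prop :=
  forall (n : nat) (xi : seqspace Theta) (B : set (seqspace R)),
    measurable B -> P xi [set w | B (Y n (xi, w))] = eta (xi n) B.

Local Open Scope ereal_scope.

Definition total_mass (n : nat) (z : seqspace Theta * W) : \bar R :=
  \sum_(i <oo) (Y n z i)%:E.

Definition nb_positive (n : nat) (z : seqspace Theta * W) : \bar R :=
  \sum_(i <oo) ((0 < Y n z i)%R%:R)%:E.

(* A quantity depending on xi only is integrated against tau, which is the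
   first marginal of the annealed law; it may be +oo inside the logarithm. *)
Definition standing_assumption : Prop := forall n : nat,
  [/\ {ae tau, forall xi, \int[P xi]_w total_mass n (xi, w) = 1},
      {ae tau, forall xi, P xi [set w | nb_positive n (xi, w) < +oo] = 1}
    & 0 < \int[tau]_xi lne (\int[P xi]_w nb_positive n (xi, w))].

Definition logp (x : R) : R := Num.max 0%R (ln x).

Definition functional_equation (phi : seqspace Theta -> R -> R) : Prop :=
  forall u : R, (0 <= u)%R ->
  {ae tau, forall xi, (phi xi u)%:E =
    \int[P xi]_w
      (limn (fun m => \prod_(i < m) phi (env_shift xi) (u * Y 0%N (xi, w) i)))%:E}.

End model.

Definition class_L d (Theta : measurableType d) (R : realType)
    (tau : probability (seqspace Theta) R) (c : R)
    (phi : seqspace Theta -> R -> R) : Prop :=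
  exists mu : R.-pker (seqspace Theta) ~> R,
  [/\ forall xi, mu xi `[0, +oo[%classic = 1%E,
      (\int[tau]_xi \int[mu xi]_(x in `[0%R, +oo[) x%:E = c%:E)%E
    & forall (xi : seqspace Theta) (u : R), (0 <= u)%R ->
      (phi xi u)%:E = (\int[mu xi]_(x in `[0%R, +oo[) (expR (- (u * x)))%:E)%E].

(* Main.v *)
(* Write g_j(xi) = e^j (1 - phi(xi, e^-j)): it is nonnegative, nondecreasing in j
   and bounded by the mean of mu_xi.  Since the quenched mean of the total mass is
   1, the functional equation reads
     g_j(xi) = E_xi [sum_i y_i g(T xi, j - log y_i)] - a_j(xi),
   where the nonnegative defect a_j compares sum_i (1 - phi_i) with
   1 - prod_i phi_i.  Summing over j < N, monotonicity telescopes the shift by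
   log y_i:
     sum_(j < N) g(T xi, j - log y_i)
       <= sum_(j < N) g_j(T xi) + (1 + log^- y_i) mean(T xi).
   After integration in xi the sums of g_j cancel by stationarity, and the
   independence of xi_0 and T xi gives sum_(j < N) E a_j <= E sum_i y_i (1 + log^- y_i),
   which is finite uniformly in N.  On the other hand, since 1 - prod <= 1, on the
   event {1 - phi(T xi, 1) >= kappa} one has
     a_j >= E_xi (kappa sum_i y_i 1_{y_i <= e^j} - e^j)^+,
   and summing this over j produces E [S log^+ S] for the total mass S, up to the
   finite E sum_i y_i log^+ y_i.  Hence E [S |log S|] would be finite.  *)

From HB Require Import structures.
Require Import Defs.
From mathcomp Require Import all_boot all_order all_algebra.
From mathcomp Require Import finmap.
From mathcomp Require Import all_classical all_reals all_analysis.
From mathcomp Require Import measurable_realfun.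
From mathcomp Require Import zify ring lra.

Set Implicit Arguments.
Unset Strict Implicit.
Unset Printing Implicit Defensive.

Import Order.TTheory GRing.Theory Num.Theory.
Import numFieldNormedType.Exports.

Local Open Scope classical_set_scope.
Local Open Scope ring_scope.

(** * Elementary real inequalities *)

(** [w |-> 1 - e^(-wx)] is concave and vanishes at 0, so its ratio to [w] does not increase; the
    division-free form admits [v = 0]. The bounds [1 + t <= e^t] at [t = (v - w)x] and [t = vx] are
    multiplied by [e^(-vx)] and added with weights [v] and [w - v]. *)
Lemma onem_expRN_concave (R : realType) (v w x : R) : 0 <= v -> v <= w -> 0 <= x ->
  v * (1 - expR (- (w * x))) <= w * (1 - expR (- (v * x))).
Proof.
move=> v0 vw x0.
have e1 : 1 + (v * x - w * x) <= expR (v * x - w * x) by exact: expR_ge1Dx.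
have e2 : 1 + v * x <= expR (v * x) by exact: expR_ge1Dx.
have -> : expR (- (w * x)) = expR (- (v * x)) * expR (v * x - w * x).
  by rewrite -expRD; congr (expR _); ring.
have ee : expR (- (v * x)) * expR (v * x) = 1 by rewrite -expRD addNr expR0.
have E0 : 0 < expR (- (v * x)) by exact: expR_gt0.
set E := expR (- (v * x)) in ee E0 *.
have k1 : E * (1 + (v * x - w * x)) <= E * expR (v * x - w * x) by rewrite ler_pM2l.
have k2 : E * (1 + v * x) <= 1 by rewrite -[leRHS]ee ler_pM2l.
have k3 : v * (E * (1 + (v * x - w * x))) <= v * (E * expR (v * x - w * x)).
  exact: ler_wpM2l.
have k4 : (w - v) * (E * (1 + v * x)) <= (w - v) * 1.
  by apply: ler_wpM2l => //; rewrite subr_ge0.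
have k5 : v * (E * (1 + (v * x - w * x))) + (w - v) * (E * (1 + v * x)) = w * E by ring.
nra.
Qed.

(** Each move of the summation window by one place adds a value that is at most [c] and drops a
    nonnegative one. *)
Lemma sum_shift_le (R : realType) (f : nat -> R) (c : R) (N n : nat) :
  {homo f : i j / (i <= j)%N >-> i <= j} -> (forall i, 0 <= f i <= c) ->
  \sum_(j < N) f (j + n)%N <= \sum_(j < N) f j + n%:R * c.
Proof.
move=> fh f0c; elim: n => [|n IH].
  by rewrite mul0r addr0; apply: ler_sum => i _; rewrite addn0.
have : \sum_(j < N) f (j + n.+1)%N <= \sum_(j < N) f (j + n)%N + c; last first.
  by rewrite -natr1 mulrDl mul1r; lra.
elim: N {IH} => [|N IH]; first by rewrite !big_ord0 add0r; have := f0c 0%N; lra.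
suff H M : \sum_(j < M) f (j + n.+1)%N = \sum_(j < M) f (j + n)%N + f (M + n)%N - f n.
  by rewrite H; have /andP[_] := f0c (N.+1 + n)%N; have /andP[] := f0c n; lra.
elim: M => [|M IHM]; first by rewrite !big_ord0 add0n; ring.
by rewrite !big_ord_recr /= IHM addnS addSn; ring.
Qed.

Lemma onem_prod_le (R : realType) (x : nat -> R) (m : nat) :
  (forall i, 0 <= x i <= 1) -> 1 - \prod_(i < m) x i <= \sum_(i < m) (1 - x i).
Proof.
move=> x01; elim: m => [|m IH]; first by rewrite !big_ord0 subrr.
rewrite !big_ord_recr /=; have /andP[a b] := x01 m.
have p1 : \prod_(i < m) x i <= 1.
  by apply: prodr_ile1 => i _; exact: x01.
nra.
Qed.

(** The negative part of the logarithm. As [ln] is 0 off the positive reals, it is finite at 0 too,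
    where it will be multiplied by [x = 0]. *)
Definition neglog (R : realType) (x : R) : R := Num.max 0 (- ln x).

(** * Telescoping along the scales [e^-j] for functions shaped like a Laplace transform *)

Section laplace_like.
Variables (R : realType) (phi : R -> R) (c : R).
Hypotheses (phi0 : phi 0 = 1) (phi01 : forall v : R, 0 <= v -> 0 <= phi v <= 1)
  (phi_concave : forall v w : R, 0 <= v -> v <= w -> v * (1 - phi w) <= w * (1 - phi v))
  (phi_lip : forall v : R, 0 <= v -> 1 - phi v <= v * c).

(** The [g_j] of the overview: the slope of the chord of [1 - phi] between 0 and [e^-j]. *)
Definition slope (j : nat) : R := expR j%:R * (1 - phi (expR (- j%:R))).

Lemma slope_ge0 j : 0 <= slope j.
Proof.
apply: mulr_ge0; first exact: expR_ge0.
by have /andP[_] := phi01 (expR_ge0 (- j%:R)); lra.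
Qed.

Lemma slope_le j : slope j <= c.
Proof.
have h := phi_lip (expR_ge0 (- j%:R)).
rewrite /slope; have := ler_wpM2l (expR_ge0 j%:R) h.
by rewrite mulrA -expRD subrr expR0 mul1r.
Qed.

(** Chord slopes of [1 - phi] from 0 do not increase with the endpoint, and [e^-(j + n) <= e^-j v].
    The integer [n] replaces the real shift [-log v], so that only slopes at integer indices
    occur. *)
Lemma scaled_le_slope (v : R) (j n : nat) : 0 <= v -> expR (- n%:R) <= v ->
  expR j%:R * (1 - phi (expR (- j%:R) * v)) <= v * slope (j + n).
Proof.
move=> v0 nv.
have h1 : expR (- (j + n)%:R) <= expR (- j%:R) * v.
  by rewrite natrD opprD expRD ler_wpM2l// expR_ge0.
have := phi_concave (expR_ge0 _) h1.
set a := expR (- (j + n)%:R); set p := 1 - phi (_ * v); set q := 1 - phi a.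
move=> h.
have : (expR j%:R * expR (j + n)%:R) * (a * p) <=
       (expR j%:R * expR (j + n)%:R) * (expR (- j%:R) * v * q).
  by apply: ler_wpM2l => //; rewrite mulr_ge0 ?expR_ge0.
have E1 : expR (j + n)%:R * a = 1 :> R by rewrite -expRD subrr expR0.
have E2 : expR j%:R * expR (- j%:R) = 1 :> R by rewrite -expRD subrr expR0.
rewrite /slope -/a -/q.
have -> : expR j%:R * expR (j + n)%:R * (a * p) = (expR (j + n)%:R * a) * (expR j%:R * p) by ring.
have -> : expR j%:R * expR (j + n)%:R * (expR (- j%:R) * v * q) =
  (expR j%:R * expR (- j%:R)) * (v * (expR (j + n)%:R * q)) by ring.
by rewrite E1 E2 !mul1r.
Qed.

Lemma slope_nondecreasing : {homo slope : i j / (i <= j)%N >-> i <= j}.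
Proof.
move=> i j ij.
have := @scaled_le_slope 1 i (j - i) ler01.
rewrite mulr1 mul1r subnKC//; apply.
by rewrite -expR0 ler_expR oppr_le0.
Qed.

Lemma sum_scaled_le (v : R) (N : nat) : 0 <= v ->
  \sum_(j < N) expR j%:R * (1 - phi (expR (- j%:R) * v)) <=
  v * (\sum_(j < N) slope j) + c * (v * (1 + neglog v)).
Proof.
move=> v0.
(* No [n] satisfies [e^-n <= 0], but at [v = 0] every term vanishes. *)
have [->|vn0] := eqVneq v 0.
  rewrite mul0r add0r mul0r mulr0 big1// => j _.
  by rewrite mulr0 phi0 subrr mulr0.
have vp : 0 < v by rewrite lt_neqAle eq_sym vn0.
(* [n] exceeds [-ln v] and is at most [1 + neglog v]; the 1 is the cost of rounding up. *)
pose n := (Num.truncn (neglog v)).+1.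
have nl0 : 0 <= neglog v by rewrite le_max lexx.
have nub : n%:R <= 1 + neglog v.
  by rewrite /n -natr1 addrC lerD2l truncn_le.
have nlb : expR (- n%:R) <= v.
  rewrite -[leRHS](lnK (x := v)) ?posrE// ler_expR lerNl.
  apply: (@le_trans _ _ (neglog v)); first by rewrite le_max lexx orbT.
  by apply/ltW; rewrite /n truncnS_gt.
have : \sum_(j < N) expR j%:R * (1 - phi (expR (- j%:R) * v)) <=
       v * \sum_(j < N) slope (j + n).
  by rewrite mulr_sumr; apply: ler_sum => j _; exact: scaled_le_slope.
move=> /le_trans; apply.
have c0 : 0 <= c := le_trans (slope_ge0 0) (slope_le 0).
have := @sum_shift_le _ slope c N n slope_nondecreasing.
move=> /(_ (fun i => introT andP (conj (slope_ge0 i) (slope_le i)))) h.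
apply: (@le_trans _ _ (v * (\sum_(j < N) slope j + n%:R * c))).
  exact: ler_wpM2l.
by rewrite mulrDr lerD2l [leRHS]mulrCA ler_wpM2l// mulrC ler_wpM2l.
Qed.

(* Since [1 - prod <= 1], the left-hand side is at most the maximum of its first
   term and of [kappa * \sum_i ...]; each of the two is below the right-hand side. *)
Lemma sum_scaled_ge (y : nat -> R) (j m : nat) (kappa : R) :
  (forall i, 0 <= y i) -> 0 <= kappa -> kappa <= 1 - phi 1 ->
  expR j%:R * (1 - \prod_(i < m) phi (expR (- j%:R) * y i)) +
  Num.max 0 (kappa * (\sum_(i < m) y i * (y i <= expR j%:R)%R%:R) - expR j%:R)
  <= expR j%:R * \sum_(i < m) (1 - phi (expR (- j%:R) * y i)).
Proof.
move=> y0 k0 kphi.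
have x01 i : 0 <= phi (expR (- j%:R) * y i) <= 1.
  by apply: phi01; rewrite mulr_ge0 ?expR_ge0.
have h1 := onem_prod_le m x01.
have ej : 0 <= expR j%:R :> R := expR_ge0 _.
have p0 : 0 <= \prod_(i < m) phi (expR (- j%:R) * y i).
  by apply: prodr_ge0 => i _; case/andP: (x01 i).
have h2 : kappa * (\sum_(i < m) y i * (y i <= expR j%:R)%R%:R) <=
  expR j%:R * \sum_(i < m) (1 - phi (expR (- j%:R) * y i)).
  rewrite !mulr_sumr; apply: ler_sum => i _.
  have [yj|yj] := boolP (y i <= expR j%:R); last first.
    rewrite !mulr0 mulr_ge0//; have := x01 i; lra.
  rewrite mulr1.
  (* An entry below [e^j] is rescaled into [[0, 1]], where concavity compares [1 - phi] with its
     value at 1, which is at least [kappa]. *)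
  have ey : expR (- j%:R) * y i <= 1.
    by rewrite expRN mulrC ler_pdivrMr ?mul1r ?expR_gt0.
  have ey0 : 0 <= expR (- j%:R) * y i by rewrite mulr_ge0 ?expR_ge0.
  have := phi_concave ey0 ey.
  rewrite mul1r => h3.
  have : expR j%:R * (expR (- j%:R) * y i * (1 - phi 1)) <=
         expR j%:R * (1 - phi (expR (- j%:R) * y i)) by exact: ler_wpM2l.
  rewrite !mulrA -expRD subrr expR0 mul1r.
  apply: le_trans; rewrite mulrC.
  exact: ler_wpM2l.
rewrite /Num.max; case: ifP => h.
  have h3 : expR j%:R * (1 - \prod_(i < m) phi (expR (- j%:R) * y i)) <= expR j%:R.
    by rewrite ger_pMr ?expR_gt0//; lra.
  lra.
by rewrite addr0; exact: ler_wpM2l.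
Qed.

End laplace_like.

(** Every [j] that counts is at most [logp y], and there are at most [1 + logp y] such naturals. *)
Lemma sum_lt_expR_le (R : realType) (y : R) (M : nat) :
  \sum_(j < M) ((expR j%:R < y)%R%:R : R) <= 1 + logp y.
Proof.
have l0 : 0 <= logp y by rewrite le_max lexx.
pose n := (Num.truncn (logp y)).+1.
have nub : n%:R <= 1 + logp y by rewrite /n -natr1 addrC lerD2l truncn_le.
have nlb : logp y < n%:R by rewrite truncnS_gt.
apply: le_trans nub.
have H (j : 'I_M) : ((expR j%:R < y)%R%:R : R) <= (j < n)%N%:R.
  have [ey|_] := boolP (expR j%:R < y); last by rewrite ler0n.
  have y0 : 0 < y := lt_trans (expR_gt0 _) ey.
  rewrite (_ : (j < n)%N = true)//.
  rewrite -(ltr_nat R); apply: le_lt_trans nlb.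
  rewrite le_max; apply/orP; right.
  by rewrite -[leLHS](expRK (R := R)) ler_ln ?posrE ?expR_gt0// ltW.
apply: le_trans (ler_sum _ (fun j _ => H j)) _.
rewrite -natr_sum ler_nat.
suff -> : (\sum_(j < M) (j < n) = minn M n)%N by exact: geq_minr.
elim: (M) => [|k IH]; first by rewrite big_ord0 min0n.
by rewrite big_ord_recr /= IH; lia.
Qed.

(** Put [L = ln (kappa S / 2)]. For each [j < L], the [j]-th maximum plus [kappa] times the entries
    above [e^j] is at least [kappa S / 2]; there are about [L] such [j], and an entry [y i] is added
    back at most [1 + logp (y i)] times. When [S <= 1] or [L <= 0] the first two terms on the right
    suffice. *)
Lemma xlnx_le (R : realType) (y : nat -> R) (m : nat) (kappa : R)
    (S := \sum_(i < m) y i) :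
  (forall i, 0 <= y i) -> 0 < kappa -> kappa <= 1 -> 0 < S ->
  exists M, S * `|ln S| <=
    1 + (3 - ln (kappa / 2)) * S + 2 * (\sum_(i < m) y i * logp (y i)) +
    2 / kappa * \sum_(j < M)
      Num.max 0 (kappa * (\sum_(i < m) y i * (y i <= expR j%:R)%R%:R) - expR j%:R).
Proof.
move=> y0 k0 k1 S0.
set l := ln (kappa / 2).
have l0 : l <= 0 by apply: ln_le0; lra.
set A := \sum_(i < m) y i * logp (y i).
have A0 : 0 <= A.
  by apply: sumr_ge0 => i _; rewrite mulr_ge0// le_max lexx.
have tk : 0 <= 2 / kappa by apply: divr_ge0; lra.
have [S1|S1] := lerP S 1.
  exists 0%N; rewrite big_ord0 mulr0 addr0.
  rewrite ler0_norm ?ln_le0//.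
  (* This yields [- S ln S <= 1 - S]. *)
  have : ln (1 + (S^-1 - 1)) <= S^-1 - 1.
    by apply: le_ln1Dx; rewrite ltrBrDr addNr invr_gt0.
  rewrite addrC subrK lnV ?posrE// => h.
  have := ler_wpM2l (ltW S0) h; rewrite mulrBr mulfV ?gt_eqF// => h2.
  nra.
have lS : 0 < ln S by exact: ln_gt0.
rewrite gtr0_norm//.
have kS : 0 < kappa * S / 2 by apply: divr_gt0 => //; exact: mulr_gt0.
have LE : ln (kappa * S / 2) = l + ln S.
  by rewrite mulrAC lnM ?posrE// divr_gt0.
have [L0|L0] := lerP (ln (kappa * S / 2)) 0.
  by exists 0%N; rewrite big_ord0 mulr0 addr0; nra.
set L := ln (kappa * S / 2) in LE L0.
pose M := Num.truncn L; exists M.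
have /andP[ML LM] : M%:R <= L < M.+1%:R by apply: truncn_itv; exact: ltW.
set H := \sum_(j < M) _.
(* After multiplication by [2 / kappa] the left side is [(ln S + ln (kappa / 2) - 1) S]; the
   constant 3 collects this 1 and the 2 coming from [kappa * S]. *)
suff : (L - 1) * (kappa * S / 2) <= H + kappa * (S + A).
  move=> /(ler_wpM2l tk).
  have -> : 2 / kappa * ((L - 1) * (kappa * S / 2)) = (L - 1) * S.
    by field; rewrite gt_eqF.
  have -> : 2 / kappa * (H + kappa * (S + A)) = 2 / kappa * H + 2 * (S + A).
    by field; rewrite gt_eqF.
  rewrite LE; nra.
have hj (j : 'I_M) : kappa * S / 2 <=
    Num.max 0 (kappa * (\sum_(i < m) y i * (y i <= expR j%:R)%R%:R) - expR j%:R)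
    + kappa * \sum_(i < m) y i * (expR j%:R < y i)%R%:R.
  have SE : S = \sum_(i < m) y i * (y i <= expR j%:R)%R%:R +
                \sum_(i < m) y i * (expR j%:R < y i)%R%:R.
    rewrite -big_split /=; apply: eq_bigr => i _.
    by case: leP => _; rewrite ?mulr1 ?mulr0 ?addr0 ?add0r.
  have ej : expR j%:R <= kappa * S / 2.
    rewrite -[leRHS](lnK (x := _)) ?posrE// ler_expR.
    by apply: le_trans ML; rewrite ler_nat ltnW.
  set a := \sum_(i < m) _ in SE *; set b := \sum_(i < m) _ in SE *.
  have : kappa * a - expR j%:R <= Num.max 0 (kappa * a - expR j%:R).
    by rewrite le_max lexx orbT.
  nra.
have : \sum_(j < M) (kappa * S / 2) <= H + kappa * (S + A).
  apply: le_trans (ler_sum _ (fun j _ => hj j)) _.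
  rewrite big_split /= lerD2l -mulr_sumr ler_pM2l// exchange_big /=.
  rewrite /S /A -big_split /=; apply: ler_sum => i _.
  rewrite -mulr_sumr -[X in X + _]mulr1 -mulrDr ler_wpM2l//.
  exact: sum_lt_expR_le.
apply: le_trans.
rewrite sumr_const card_ord -[leRHS]mulr_natl ler_pM2r//.
by rewrite -natr1 in LM; lra.
Qed.

Local Open Scope ereal_scope.

(** * Integrals off a null set; sequence spaces *)

(* No measurability is assumed: a solution [phi xi] of the functional equation is
   arbitrary on negative reals, so its integrand is only controlled off the null
   set where the sequence is not nonnegative. *)
Section integral_off_null.
Context d (T : measurableType d) (R : realType) (mu : {measure set T -> \bar R}).
Variables (N : set T) (mN : measurable N) (muN : mu N = 0).

Import HBNNSimple.

(** The integral is a supremum over simple functions [h <= f]. Cutting [h] to 0 on [N] leaves its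
    integral unchanged and puts it below [g] everywhere. *)
Lemma ge0_le_integral_off_null (f g : T -> \bar R) :
  (forall x, 0 <= f x) -> (forall x, 0 <= g x) ->
  (forall x, ~ N x -> f x <= g x) -> \int[mu]_x f x <= \int[mu]_x g x.
Proof.
move=> f0 g0 fg; rewrite ge0_integralTE// [leRHS]ge0_integralTE//.
apply/ge_ereal_sup => _ [h hf <-].
pose h1 : {nnsfun T >-> R} := mul_nnsfun h (indic_nnsfun R (measurableC mN)).
have -> : sintegral mu h = sintegral mu h1.
  rewrite -!integralT_nnsfun; apply: ge0_ae_eq_integral => //.
  - exact/measurable_EFinP.
  - exact/measurable_EFinP.
  - by move=> x _; rewrite lee_fin.
  - by move=> x _; rewrite lee_fin.
  - exists N; split => // x /=; apply: contra_notP => Nx _.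
    by rewrite /h1 /= mindicE mem_set// mulr1.
apply: ereal_sup_ubound; exists h1 => // x.
rewrite /h1 /= mindicE; have [xN|xN] := pselect (N x).
  by rewrite memNset ?mulr0//; exact.
by rewrite mem_set// mulr1; apply: le_trans (fg _ xN).
Qed.

Lemma eq_integral_off_null (f g : T -> \bar R) :
  (forall x, ~ N x -> f x = g x) -> \int[mu]_x f x = \int[mu]_x g x.
Proof.
move=> fg; rewrite integralE [RHS]integralE.
by congr (_ - _); apply/eqP; rewrite eq_le !ge0_le_integral_off_null// => x /fg h;
  rewrite ?funeposE ?funenegE h.
Qed.

End integral_off_null.

Section seqspace_theory.
Context d (T : measurableType d).

Lemma measurable_coord (n : nat) :
  measurable_fun [set: seqspace T] (fun x : seqspace T => x n).
Proof.
move=> _ A mA; rewrite setTI; apply: sub_sigma_algebra.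
by exists n, A.
Qed.

Lemma measurable_env_shift : measurable_fun [set: seqspace T] (@env_shift _ T).
Proof.
apply: (@measurability _ _ (seqspace T) (seqspace T) _ _ (coordinate_preimages T)) => //.
move=> _ [_ [n [A [mA ->]]] <-].
by have := measurable_coord n.+1 measurableT mA; rewrite !setTI.
Qed.

(** Conditions on finitely many coordinates at once, unlike [coordinate_preimages], form a family
    stable under intersection, as uniqueness of measures requires. *)
Definition cylinder : set (set (seqspace T)) :=
  [set C | exists n (A : nat -> set T), (forall i, measurable (A i)) /\
    C = [set x | forall i, (i < n)%N -> A i (x i)]].

Lemma cylinder_setI_closed : setI_closed cylinder.
Proof.
move=> _ _ [n [A [mA ->]]] [m [B [mB ->]]].
(* The shorter of the two lists of conditions is padded with [setT]. *)
exists (maxn n m), (fun i => (if (i < n)%N then A i else setT) `&`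
  (if (i < m)%N then B i else setT)); split.
  by move=> i; apply: measurableI; case: ifP.
apply/seteqP; split => x /=.
  by move=> [hA hB] i _; split; case: ifP => // im; [exact: hA|exact: hB].
move=> h; split => i im.
  by have := h i; rewrite leq_max im => /(_ isT) [].
by have := h i; rewrite leq_max im orbT => /(_ isT) [].
Qed.

Lemma measurable_cylinder : cylinder `<=` @measurable _ (seqspace T).
Proof.
move=> _ [n [A [mA ->]]].
rewrite (_ : mkset _ = \bigcap_(i < n) [set x : seqspace T | A i (x i)]).
  by apply: bigcap_measurableType => i _; have := measurable_coord i measurableT (mA i); rewrite setTI.
by apply/seteqP; split => x h i /h.
Qed.

Lemma seqspace_measurableE : @measurable _ (seqspace T) = <<s cylinder >>.
Proof.
apply/seteqP; split.
  apply: smallest_sub; first exact: smallest_sigma_algebra.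
  move=> _ [n [A [mA ->]]]; apply: sub_sigma_algebra.
  exists n.+1, (fun i => if i == n then A else setT); split.
    by move=> i; case: ifP.
  apply/seteqP; split => x /=; first by move=> Ax i _; case: eqP => // ->.
  by move=> /(_ n); rewrite eqxx; apply.
apply: smallest_sub; last exact: measurable_cylinder.
exact: sigma_algebra_measurable.
Qed.

End seqspace_theory.

(** * Independence of the first coordinate and the shift *)

Section iid_theory.
Context d (T : measurableType d) (R : realType) (tau : probability (seqspace T) R).
Hypothesis tau_iid : iid tau.

Lemma iid_cylinder (n : nat) (A : nat -> set T) : (forall i, measurable (A i)) ->
  tau [set x | forall i, (i < n)%N -> A i (x i)] =
  \prod_(0 <= i < n) tau [set x | A i (x 0%N)].
Proof.
move=> mA; have [stat indep] := tau_iid.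
have := indep [fset i | i in iota 0 n]%fset A mA.
have -> : [set x : seqspace T | forall i, i \in [fset i | i in iota 0 n]%fset -> A i (x i)] =
          [set x | forall i, (i < n)%N -> A i (x i)].
  by apply/seteqP; split => x /= h i hi; apply: h; move: hi; rewrite inE /= mem_iota.
move=> ->; rewrite (perm_big (iota 0 n)) /=; last first.
  apply: uniq_perm; [exact: fset_uniq|exact: iota_uniq|].
  by move=> i; rewrite inE.
by rewrite /index_iota subn0; apply: eq_bigr => i _; rewrite stat.
Qed.

(** As functions of [B], both sides are finite measures, [m1] and [m2]; they agree on cylinders,
    hence on the generated sigma-algebra. *)
Lemma iid_head_shift (A : set T) (B : set (seqspace T)) :
  measurable A -> measurable B ->
  tau [set x | A (x 0%N) /\ B (env_shift x)] = tau [set x | A (x 0%N)] * tau B.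
Proof.
move=> mA mB.
have mA0 : measurable [set x : seqspace T | A (x 0%N)].
  by have := measurable_coord 0 measurableT mA; rewrite setTI.
have tA : tau [set x | A (x 0%N)] \is a fin_num by exact: fin_num_measure.
have a0 : (0 <= fine (tau [set x : seqspace T | A (x 0%N)]))%R by exact: fine_ge0.
have ms := @measurable_env_shift _ T.
pose m1 : {measure set (seqspace T) -> \bar R} := pushforward (mrestr tau mA0) (@env_shift _ T).
pose m2 : {measure set (seqspace T) -> \bar R} := mscale (NngNum a0) tau.
have H := @measure_unique _ R (seqspace T) (@cylinder _ T) (fun=> setT)
  (@seqspace_measurableE _ T) (@cylinder_setI_closed _ T) _ _ (m1 ms) m2 _ _ B mB.
transitivity (m1 ms B).
  by rewrite /m1 /= /pushforward /mrestr setIC.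
rewrite H; first by rewrite /m2 /= /mscale /= fineK.
- by move=> _; exists 0%N, (fun=> setT); split => //; apply/seteqP; split.
- by apply/seteqP; split => // x _; exists 0%N.
- move=> _ [n [C [mC ->]]].
  rewrite /m1 /m2 /= /pushforward /mrestr /mscale /= fineK//.
  (* A condition on the head together with a cylinder condition of length [n] on the shift is a
     cylinder condition of length [n.+1]. *)
  pose A' i := if i is j.+1 then C j else A.
  rewrite iid_cylinder//.
  transitivity (tau [set x | forall i, (i < n.+1)%N -> A' i (x i)]).
    congr (tau _); apply/seteqP; split => x /=.
      by move=> [h Ax] [|i] //= /h.
    by move=> h; split => [i ?|]; [exact: (h i.+1)|exact: (h 0%N)].
  have mA' i : measurable (A' i) by case: i => [|i]; [exact: mA|exact: mC].
  rewrite iid_cylinder//.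
  by rewrite big_nat_recl.
- move=> k; rewrite (@le_lt_trans _ _ 1)//; last by rewrite ltry.
  rewrite /m1 /= /pushforward /mrestr.
  by rewrite preimage_setT setTI; exact: probability_le1.
Qed.


(** Independence says that the law of the pair of head and shift agrees on rectangles with a product
    measure, hence equals it; Tonelli's theorem then separates the factors. *)
Lemma integral_iid_head_shift (F : T -> \bar R) (G : seqspace T -> \bar R) :
  measurable_fun setT F -> (forall t, 0 <= F t) ->
  measurable_fun setT G -> (forall x, 0 <= G x) ->
  \int[tau]_x (F (x 0%N) * G (env_shift x)) =
  (\int[tau]_x F (x 0%N)) * (\int[tau]_x G x).
Proof.
move=> mF F0 mG G0.
have mc := @measurable_coord _ T 0; have ms := @measurable_env_shift _ T.
pose c0 : {mfun seqspace T >-> T} := HB.pack (fun x : seqspace T => x 0%N)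
  (isMeasurableFun.Build _ _ _ _ _ mc).
have mp : measurable_fun [set: seqspace T] (fun x : seqspace T => (x 0%N, env_shift x)).
  exact: measurable_fun_pair.
pose p0 : {mfun seqspace T >-> (T * seqspace T)%type} :=
  HB.pack (fun x : seqspace T => (x 0%N, env_shift x))
  (isMeasurableFun.Build _ _ _ _ _ mp).
pose H (z : T * seqspace T) := F z.1 * G z.2.
have mH : measurable_fun setT H.
  apply: emeasurable_funM.
  - exact: measurableT_comp mF measurable_fst.
  - exact: measurableT_comp mG measurable_snd.
have H0 z : 0 <= H z by exact: mule_ge0.
transitivity (\int[distribution tau p0]_z H z).
  by rewrite ge0_integral_distribution.
transitivity (\int[(distribution tau c0 \x tau)%E]_z H z).
  apply: eq_measure_integral => /= A mA _; apply/esym.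
  apply: product_measure_unique => // B C mB mC.
  by rewrite -iid_head_shift.
rewrite fubini_tonelli1//.
transitivity (\int[distribution tau c0]_t (F t * \int[tau]_x G x)).
  by apply: eq_integral => t _; rewrite /fubini_F /H /= ge0_integralZl.
rewrite ge0_integralZr//; last exact: integral_ge0.
by rewrite ge0_integral_distribution.
Qed.

Lemma integral_env_shift (G : seqspace T -> \bar R) :
  measurable_fun setT G -> (forall x, 0 <= G x) ->
  \int[tau]_x G (env_shift x) = \int[tau]_x G x.
Proof.
move=> mG G0.
transitivity (\int[tau]_x (cst 1 (x 0%N : T) * G (env_shift x))).
  by apply: eq_integral => x _; rewrite mul1e.
rewrite (integral_iid_head_shift (F := cst 1))//.
rewrite (_ : \int[tau]_x cst 1 (x 0%N) = 1) ?mul1e//.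
transitivity (\int[tau]_x cst 1 x) => //.
by rewrite integral_cst// mul1e; exact: probability_setT.
Qed.

End iid_theory.

(** * The model *)

(* The absolute value makes the sum well behaved for every [y]; on
   [nonneg_ultimately_zero], which has full measure, it changes nothing. *)
Definition esum_abs (R : realType) (F : R -> R) (y : seqspace R) : \bar R :=
  \sum_(i <oo) (F `|y i|%R)%:E.

Section esum_abs_theory.
Context (R : realType).
Implicit Types (F G : R -> R) (y : seqspace R).

Lemma esum_abs_ge0 F y : (forall v : R, (0 <= v)%R -> (0 <= F v)%R) ->
  0 <= esum_abs F y.
Proof. by move=> F0; apply: nneseries_ge0 => i _ _; rewrite lee_fin F0. Qed.

Lemma measurable_esum_abs F : (forall v : R, (0 <= v)%R -> (0 <= F v)%R) ->
  measurable_fun setT F -> measurable_fun [set: seqspace R] (esum_abs F).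
Proof.
move=> F0 mF; apply: ge0_emeasurable_sum => [k y _ _|k _].
  by rewrite lee_fin F0.
apply/measurable_EFinP; apply: measurableT_comp => //.
by apply: measurableT_comp; [exact: normr_measurable|exact: measurable_coord].
Qed.

Lemma measurable_nonneg_ultimately_zero : measurable (nonneg_ultimately_zero R).
Proof.
rewrite (_ : nonneg_ultimately_zero R =
  (\bigcap_i [set y : seqspace R | (0 <= y i)%R]) `&`
  \bigcup_N \bigcap_(i >= N) [set y : seqspace R | y i = 0%R]).
  apply: measurableI.
    apply: bigcap_measurableType => i _.
    have mI : measurable (`[0%R, +oo[%classic : set R) by exact: measurable_itv.
    have := @measurable_coord _ R i measurableT _ mI.
    by rewrite setTI; congr (measurable _); apply/seteqP; split => y /=;
      rewrite in_itv /= andbT.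
  apply: bigcup_measurable => N _; apply: bigcap_measurableType => i _.
  have := @measurable_coord _ R i measurableT _ (measurable_set1 (0%R : R)).
  by rewrite setTI.
apply/seteqP; split => y /=.
  move=> [y0 [N yN]]; split; first by move=> i _; exact: y0.
  by exists N => // i /= Ni; exact: yN.
move=> [y0 [N _ yN]]; split=> [i|]; first exact: y0.
by exists N => i Ni; exact: yN.
Qed.

Lemma nneseries_ultimately_zero (f : nat -> R) m : (forall i, (m <= i)%N -> f i = 0%R) ->
  \sum_(i <oo) (f i)%:E = (\sum_(i < m) f i)%R%:E.
Proof.
move=> fm; apply/cvg_lim => //.
apply: cvg_near_cst; near=> n.
have mn : (m <= n)%N by near: n; exists m.
rewrite sumEFin; congr EFin.
rewrite (big_cat_nat (n := m))//= big_mkord [X in (_ + X)%R]big1_seq ?addr0// => i.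
by rewrite mem_index_iota => /andP[_ /andP[/fm]].
Unshelve. all: by end_near. Qed.

Lemma esum_abs_ultimately_zero F y m : F 0%R = 0%R -> (forall i, (0 <= y i)%R) ->
  (forall i, (m <= i)%N -> y i = 0%R) -> esum_abs F y = (\sum_(i < m) F (y i))%R%:E.
Proof.
move=> F0 y0 ym; rewrite /esum_abs (@nneseries_ultimately_zero _ m).
  by congr EFin; apply: eq_bigr => i _; rewrite ger0_norm.
by move=> i /ym ->; rewrite normr0.
Qed.

End esum_abs_theory.

(** * Quenched and annealed laws of the sequence with number 0 *)

Section model_theory.
Context d d' (Theta : measurableType d) (W : measurableType d') (R : realType).
Variables (tau : probability (seqspace Theta) R)
  (P : R.-pker (seqspace Theta) ~> W)
  (Y : nat -> {mfun (seqspace Theta * W)%type >-> seqspace R})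
  (eta : R.-pker Theta ~> seqspace R).
Hypothesis heta : forall theta, eta theta (nonneg_ultimately_zero R) = 1.
Hypothesis hY : quenched_law P Y eta.

Let mYx xi : measurable_fun setT (fun w => Y 0%N (xi, w)).
Proof. by apply: measurableT_comp => //; exact: measurable_fun_pair. Qed.

(** Change of variables under [hY]. The result depends on [xi] through [xi 0] only, which is what
    later gives independence from the shifted environment. *)
Lemma integral_quenched xi (f : seqspace R -> \bar R) :
  measurable_fun setT f -> (forall y, 0 <= f y) ->
  \int[P xi]_w f (Y 0%N (xi, w)) = \int[eta (xi 0%N)]_y f y.
Proof.
move=> mf f0.
have -> : \int[P xi]_w f (Y 0%N (xi, w)) =
    \int[pushforward (P xi) (fun w => Y 0%N (xi, w))]_y f y.
  by rewrite (ge0_integral_pushforward (mYx xi)).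
by apply: eq_measure_integral => B mB _; exact: hY.
Qed.

Let nuzC := ~` nonneg_ultimately_zero R.

Let measurable_nuzC : measurable nuzC.
Proof. by apply: measurableC; exact: measurable_nonneg_ultimately_zero. Qed.

Lemma eta_nuzC theta : eta theta nuzC = 0.
Proof.
have mS := @measurable_nonneg_ultimately_zero R.
have : eta theta (nonneg_ultimately_zero R `|` nuzC) =
    eta theta (nonneg_ultimately_zero R) + eta theta nuzC.
  by apply: measureU => //; rewrite setICr.
rewrite setUCr heta prob_kernel.
case: (eta theta nuzC) => [r| |]//; rewrite -EFinD => -[] h; congr EFin; lra.
Qed.

Lemma measurable_quenched_nuzC xi : measurable [set w | nuzC (Y 0%N (xi, w))].
Proof. by rewrite -[X in measurable X]setTI; exact: mYx. Qed.

Lemma quenched_nuzC xi : P xi [set w | nuzC (Y 0%N (xi, w))] = 0.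
Proof. by rewrite hY// eta_nuzC. Qed.

(** The factor [unit] is the source of [tau] seen as a constant kernel; the annealed law of the
    sequence is then a composition of kernels, and [integral_kcomp] applies. *)
Definition head_kernel : unit * seqspace Theta -> {measure set (seqspace R) -> \bar R} :=
  fun p => eta (p.2 0%N).

Let measurable_head_kernel U : measurable U -> measurable_fun setT (head_kernel ^~ U).
Proof.
move=> mU; rewrite /head_kernel.
have h := measurableT_comp (measurable_kernel eta U mU) (@measurable_coord _ Theta 0%N).
exact: measurableT_comp h measurable_snd.
Qed.

HB.instance Definition _ := isKernel.Build _ _ _ _ _ head_kernel measurable_head_kernel.

Let prob_head_kernel p : head_kernel p setT = 1.
Proof. exact: prob_kernel. Qed.

HB.instance Definition _ := Kernel_isProbability.Build _ _ _ _ _ head_kernel prob_head_kernel.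

Lemma annealed_preimage (B : set (seqspace R)) : measurable B ->
  annealed tau P (Y 0%N @^-1` B) = \int[tau]_x eta (x 0%N) B.
Proof.
move=> mB; apply: eq_integral => x _.
rewrite -(hY 0%N x mB) -[in RHS](setIT [set w | _]).
rewrite -integral_indic//; last by rewrite -[X in measurable X]setTI; exact: mYx.
Qed.

Lemma integral_annealed (f : seqspace R -> \bar R) :
  measurable_fun setT f -> (forall y, 0 <= f y) ->
  \int[annealed tau P]_z f (Y 0%N z) = \int[tau]_x \int[eta (x 0%N)]_y f y.
Proof.
move=> mf f0.
have -> : \int[annealed tau P]_z f (Y 0%N z) = \int[distribution (annealed tau P) (Y 0%N)]_y f y.
  by rewrite ge0_integral_distribution.
have := @integral_kcomp _ _ _ unit (seqspace Theta) (seqspace R) R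
  (kprobability (measurable_cst (tau : pprobability _ R))) head_kernel tt f f0 mf.
move=> <-.
by apply: eq_measure_integral => B mB _; rewrite /= annealed_preimage.
Qed.

Lemma annealed_nuzC : annealed tau P (Y 0%N @^-1` nuzC) = 0.
Proof.
rewrite annealed_preimage//; apply: integral0_eq => x _; exact: eta_nuzC.
Qed.

End model_theory.

(** * Laplace transforms *)

Section laplace.
Context (R : realType) (mu : {measure set R -> \bar R}).
Variable phi : R -> R.
Let I : set R := `[0%R, +oo[%classic.
Hypothesis mu1 : mu I = 1.
Hypothesis phiE : forall u : R, (0 <= u)%R ->
  (phi u)%:E = \int[mu]_(x in I) (expR (- (u * x)))%:E.

Let mI : measurable I. Proof. exact: measurable_itv. Qed.
Let I0 x : I x -> (0 <= x)%R. Proof. by rewrite /I /= in_itv /= andbT. Qed.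

Let me (v : R) : measurable_fun I (fun x => (expR (- (v * x)))%:E).
Proof.
apply/measurable_EFinP; apply: measurable_funTS.
by apply: measurableT_comp => //; apply: measurableT_comp.
Qed.

Let mo (v : R) : measurable_fun I (fun x => (1 - expR (- (v * x)))%:E).
Proof.
apply/measurable_EFinP; apply: measurable_funTS; apply: measurable_funB => //.
by apply: measurableT_comp => //; apply: measurableT_comp.
Qed.

Let o0 (v x : R) : (0 <= v)%R -> I x -> (0 <= 1 - expR (- (v * x)))%R.
Proof.
by move=> v0 /I0 x0; rewrite subr_ge0 -expR0 ler_expR oppr_le0 mulr_ge0.
Qed.

Lemma laplace_onemE (v : R) : (0 <= v)%R ->
  (1 - phi v)%:E = \int[mu]_(x in I) (1 - expR (- (v * x)))%:E.
Proof.
move=> v0.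
have : \int[mu]_(x in I) (cst 1 x) =
   \int[mu]_(x in I) (1 - expR (- (v * x)))%:E + \int[mu]_(x in I) (expR (- (v * x)))%:E.
  rewrite -ge0_integralD//.
  - by apply: eq_integral => x _; rewrite -EFinD subrK.
  - by move=> x Ix; rewrite lee_fin o0.
rewrite integral_cst// mul1e mu1 -phiE//.
by case: (\int[mu]_(x in I) _) => [r| |]//; rewrite -EFinD => -[] h; congr EFin; lra.
Qed.

Lemma laplace0 : phi 0%R = 1%R.
Proof.
have := laplace_onemE (lexx 0%R).
rewrite (_ : \int[mu]_(x in I) _ = 0); first by case; lra.
by apply: integral0_eq => x _; rewrite mul0r oppr0 expR0 subrr.
Qed.

Lemma laplace01 (v : R) : (0 <= v)%R -> (0 <= phi v <= 1)%R.
Proof.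
move=> v0; apply/andP; split.
  by rewrite -lee_fin phiE//; apply: integral_ge0 => x _; rewrite lee_fin expR_ge0.
rewrite -subr_ge0 -lee_fin laplace_onemE//; apply: integral_ge0 => x Ix.
by rewrite lee_fin o0.
Qed.

Lemma laplace_concave (v w : R) : (0 <= v)%R -> (v <= w)%R ->
  (v * (1 - phi w) <= w * (1 - phi v))%R.
Proof.
move=> v0 vw; have w0 := le_trans v0 vw.
rewrite -lee_fin !EFinM !laplace_onemE// -!ge0_integralZl_EFin//; try by
  move=> x Ix; rewrite lee_fin o0.
apply: ge0_le_integral => //.
- by move=> x Ix; rewrite lee_fin mulr_ge0// o0.
- by apply: measurable_funeM.
- by apply: measurable_funeM.
- by move=> x /I0 x0; rewrite lee_fin onem_expRN_concave.
Qed.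

Lemma laplace_nonincreasing (v w : R) : (0 <= v)%R -> (v <= w)%R -> (phi w <= phi v)%R.
Proof.
move=> v0 vw; rewrite -lee_fin !phiE ?(le_trans v0 vw)//.
apply: ge0_le_integral => //.
by move=> x /I0 x0; rewrite lee_fin ler_expR lerN2 ler_wpM2r.
Qed.

(** From [1 - e^-t <= t]. The mean stays an extended real, since it may be infinite for exceptional
    environments. *)
Lemma laplace_lip (v : R) : (0 <= v)%R ->
  (1 - phi v)%:E <= v%:E * \int[mu]_(x in I) x%:E.
Proof.
move=> v0; rewrite laplace_onemE// -ge0_integralZl_EFin//.
apply: ge0_le_integral => //.
- by move=> x Ix; rewrite lee_fin o0.
- by apply: measurable_funeM; apply/measurable_EFinP.
- move=> x /I0 x0; rewrite lee_fin.
  by have := expR_ge1Dx (- (v * x))%R; lra.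
Qed.

(** The nonnegative function [1 - e^-x] then has integral 0, so [x = 0] almost everywhere for
    [mu]. *)
Lemma laplace_eq1 : phi 1%R = 1%R -> \int[mu]_(x in I) x%:E = 0.
Proof.
move=> phi1; have := laplace_onemE ler01; rewrite phi1 subrr => /esym h.
have : \int[mu]_(x in I) `|(1 - expR (- (1 * x)))%:E| = 0.
  rewrite -[RHS]h; apply: eq_integral => x; rewrite inE => Ix.
  by rewrite gee0_abs// lee_fin o0.
move/(ae_eq_integral_abs mu mI (mo 1)) => ae.
rewrite (ae_eq_integral (cst 0)) ?integral0//.
apply: filterS ae => x hx Ix; have := hx Ix.
rewrite /= mul1r => -[] e.
have /expR_inj/eqP : expR (- x) = expR 0 :> R by rewrite expR0; lra.
by rewrite oppr_eq0 => /eqP ->.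
Qed.

End laplace.

(** * One step of the functional equation *)

Definition truncated (R : realType) (j : nat) (v : R) : R := v * (v <= expR j%:R)%R%:R.

(** The integrand of the lower bound for the defect [a_j] in the overview. *)
Definition excess (R : realType) (kappa : R) (j : nat) (y : seqspace R) : \bar R :=
  maxe 0 (kappa%:E * esum_abs (truncated j) y - (expR j%:R)%:E).

Definition with_neglog (R : realType) (v : R) : R := v * (1 + neglog v).

Section weights.
Variable R : realType.

Lemma truncated_ge0 j (v : R) : (0 <= v)%R -> (0 <= truncated j v)%R.
Proof. by move=> v0; rewrite mulr_ge0. Qed.

Lemma measurable_truncated j : measurable_fun [set: R] (@truncated R j).
Proof.
apply: measurable_funM => //.
apply: measurableT_comp => //.
by apply: measurable_fun_ler.
Qed.

Lemma neglog_ge0 (v : R) : (0 <= neglog v)%R.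
Proof. by rewrite le_max lexx. Qed.

Lemma with_neglog_ge0 (v : R) : (0 <= v)%R -> (0 <= with_neglog v)%R.
Proof. by move=> v0; rewrite mulr_ge0// addr_ge0// neglog_ge0. Qed.

Lemma measurable_neglog : measurable_fun [set: R] (@neglog R).
Proof.
by apply: measurable_maxr => //; apply: measurableT_comp.
Qed.

Lemma measurable_with_neglog : measurable_fun [set: R] (@with_neglog R).
Proof.
apply: measurable_funM => //; apply: measurable_funD => //; exact: measurable_neglog.
Qed.

Lemma measurable_excess kappa j : measurable_fun [set: seqspace R] (excess kappa j).
Proof.
apply: measurable_maxe => //; apply: emeasurable_funB => //.
apply: measurable_funeM; apply: measurable_esum_abs; first exact: truncated_ge0.
exact: measurable_truncated.
Qed.

Lemma excess_ge0 kappa j (y : seqspace R) : 0 <= excess kappa j y.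
Proof. by rewrite le_max lexx. Qed.

End weights.

(** * A fixed environment: [nu] is the law of its sequence, [phi] the transform at the shifted
    environment *)

Section one_step.
Context (R : realType) (nu : {measure set (seqspace R) -> \bar R}).
Hypotheses (nuT : nu setT = 1) (nu_nuz : nu (~` nonneg_ultimately_zero R) = 0)
  (nu_mass : \int[nu]_y esum_abs id y = 1).
Variables (phi : R -> R) (c : R).
Hypotheses (phi0 : phi 0%R = 1%R) (phi01 : forall v : R, (0 <= v)%R -> (0 <= phi v <= 1)%R)
  (phi_concave : forall v w : R, (0 <= v)%R -> (v <= w)%R -> (v * (1 - phi w) <= w * (1 - phi v))%R)
  (phi_ni : forall v w : R, (0 <= v)%R -> (v <= w)%R -> (phi w <= phi v)%R)
  (phi_lip : forall v : R, (0 <= v)%R -> (1 - phi v <= v * c)%R).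

(** With absolute values, the arguments of [phi] are nonnegative for every [y] when [0 <= u], so the
    partial products decrease and the limit exists and is measurable without restriction. *)
Definition prod_abs (u : R) (y : seqspace R) : R :=
  limn (fun m => \prod_(i < m) phi (u * `|y i|))%R.

Let term01 (u : R) (y : seqspace R) i : (0 <= u)%R -> (0 <= phi (u * `|y i|) <= 1)%R.
Proof. by move=> u0; apply: phi01; rewrite mulr_ge0. Qed.

Let prod01 (u : R) (y : seqspace R) m : (0 <= u)%R -> (0 <= \prod_(i < m) phi (u * `|y i|) <= 1)%R.
Proof.
move=> u0; apply/andP; split.
  by apply: prodr_ge0 => i _; case/andP: (term01 y i u0).
by apply: prodr_ile1 => i _; exact: term01.
Qed.

Lemma cvg_prod_abs (u : R) (y : seqspace R) : (0 <= u)%R ->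
  (fun m => \prod_(i < m) phi (u * `|y i|))%R @ \oo --> prod_abs u y.
Proof.
move=> u0; apply: (@nonincreasing_is_cvgn R).
  apply/nonincreasing_seqP => m; rewrite big_ord_recr /=.
  have /andP[p0 p1] := prod01 y m u0; have /andP[t0 t1] := term01 y m u0.
  exact: ler_piMr.
by exists 0%R => _ [m _ <-]; case/andP: (prod01 y m u0).
Qed.

Lemma prod_abs01 (u : R) (y : seqspace R) : (0 <= u)%R -> (0 <= prod_abs u y <= 1)%R.
Proof.
move=> u0; have h : cvgn (fun m => \prod_(i < m) phi (u * `|y i|))%R.
  by apply: cvgP; exact: cvg_prod_abs.
apply/andP; split.
  by apply: limr_ge => //; near=> m; case/andP: (prod01 y m u0).
by apply: limr_le => //; near=> m; case/andP: (prod01 y m u0).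
Unshelve. all: by end_near. Qed.

(** [phi] is controlled on nonnegative reals only, but [v |-> phi (max v 0)] is monotone on the
    whole line, hence measurable. *)
Lemma measurable_phi_scaled (u : R) : (0 <= u)%R ->
  measurable_fun [set: R] (fun v : R => phi (u * `|v|)%R).
Proof.
move=> u0.
have m1 : measurable_fun [set: R] (fun v : R => phi (Num.max v 0)%R).
  apply: nonincreasing_measurable => // v w vw.
  apply: phi_ni; first by rewrite le_max lexx orbT.
  by rewrite ge_max !le_max vw lexx !orbT.
have m2 : measurable_fun [set: R] (fun v : R => u * `|v|)%R by exact: measurable_funM.
rewrite (_ : (fun v : R => _) = (fun v : R => phi (Num.max v 0)%R) \o (fun v : R => u * `|v|)%R).
  exact: measurableT_comp.
by apply/funext => v /=; rewrite max_l// mulr_ge0.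
Qed.

Lemma measurable_prod_abs (u : R) : (0 <= u)%R -> measurable_fun setT (prod_abs u).
Proof.
move=> u0; apply: (@measurable_fun_cvg _ _ _ _ (fun m (y : seqspace R) => \prod_(i < m) phi (u * `|y i|))%R).
  move=> m; apply: measurable_prod => i _.
  exact: (measurableT_comp (measurable_phi_scaled u0) (@measurable_coord _ R i)).
by move=> y _; exact: cvg_prod_abs.
Qed.

Lemma prod_abs_ultimately_zero (u : R) (y : seqspace R) m : (0 <= u)%R -> (forall i, (0 <= y i)%R) ->
  (forall i, (m <= i)%N -> y i = 0%R) -> prod_abs u y = (\prod_(i < m) phi (u * y i))%R.
Proof.
move=> u0 y0 ym; apply/cvg_lim => //; apply: cvg_near_cst; near=> n.
have mn : (m <= n)%N by near: n; exists m.
rewrite -(big_mkord xpredT (fun i => phi (u * `|y i|)%R)).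
rewrite (big_cat_nat (n := m))//= [X in (_ * X)%R]big1_seq ?mulr1.
  by rewrite !big_mkord; apply: eq_bigr => i _; rewrite ger0_norm.
move=> i; rewrite mem_index_iota => /andP[_ /andP[/ym -> _]].
by rewrite normr0 mulr0.
Unshelve. all: by end_near. Qed.

(** [sum_scaled_ge] is applied at each scale [j], the two finite sums are exchanged, and
    [sum_scaled_le] is applied to each entry [y i]. *)
Lemma one_step_pointwise (kappa : R) N (y : seqspace R) :
  (0 <= kappa)%R -> (kappa <= 1 - phi 1)%R -> nonneg_ultimately_zero R y ->
  \sum_(j < N) ((expR j%:R * (1 - prod_abs (expR (- j%:R)) y))%:E + excess kappa j y) <=
  (\sum_(j < N) slope phi j)%:E * esum_abs id y + c%:E * esum_abs (@with_neglog R) y.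
Proof.
move=> k0 k1 [y0 [m ym]].
have e (F : R -> R) : F 0%R = 0%R -> esum_abs F y = (\sum_(i < m) F (y i))%R%:E.
  by move=> F0; exact: esum_abs_ultimately_zero.
have z1 : @with_neglog R 0%R = 0%R by rewrite /with_neglog mul0r.
have z2 j : @truncated R j 0%R = 0%R by rewrite /truncated mul0r.
rewrite !e// -!EFinM -EFinD.
have -> : \sum_(j < N) ((expR j%:R * (1 - prod_abs (expR (- j%:R)) y))%:E + excess kappa j y) =
  (\sum_(j < N) (expR j%:R * (1 - \prod_(i < m) phi (expR (- j%:R) * y i)) +
    Num.max 0 (kappa * (\sum_(i < m) y i * (y i <= expR j%:R)%R%:R) - expR j%:R)))%R%:E.
  rewrite -sumEFin; apply: eq_bigr => j _.
  rewrite (@prod_abs_ultimately_zero _ _ m)// ?expR_ge0// EFinD; congr (_ + _).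
  by rewrite /excess e// -EFinM -EFinB EFin_max.
rewrite lee_fin.
apply: (@le_trans _ _ (\sum_(j < N) expR j%:R * \sum_(i < m) (1 - phi (expR (- j%:R) * y i)))%R).
  by apply: ler_sum => j _; apply: sum_scaled_ge.
under eq_bigr do rewrite mulr_sumr.
rewrite exchange_big /= !mulr_sumr -big_split /=; apply: ler_sum => i _.
rewrite [X in (_ <= X + _)%R]mulrC.
exact: sum_scaled_le.
Qed.

(** [I j] will be [phi xi (e^-j)], its integral formula being the functional equation; the first sum
    on the left is then the sum of slopes at [xi]. *)
Lemma one_step_integral (kappa : R) (N : nat) (I : nat -> R) :
  (0 <= kappa)%R -> (kappa <= 1 - phi 1)%R ->
  (forall j, (I j)%:E = \int[nu]_y (prod_abs (expR (- j%:R)) y)%:E) ->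
  (\sum_(j < N) expR j%:R * (1 - I j))%:E + \sum_(j < N) \int[nu]_y excess kappa j y <=
  (\sum_(j < N) slope phi j)%:E + c%:E * \int[nu]_y esum_abs (@with_neglog R) y.
Proof.
move=> k0 k1 IE.
have u0 j : (0 <= expR (- j%:R) :> R)%R by exact: expR_ge0.
have p1 j y : (0 <= expR j%:R * (1 - prod_abs (expR (- j%:R)) y))%R.
  by rewrite mulr_ge0 ?expR_ge0// subr_ge0; case/andP: (prod_abs01 y (u0 j)).
have mp j : measurable_fun setT (fun y => (expR j%:R * (1 - prod_abs (expR (- j%:R)) y))%:E).
  apply/measurable_EFinP; apply: measurable_funM => //; apply: measurable_funB => //.
  exact: measurable_prod_abs.
have mo j : measurable_fun setT (fun y => (1 - prod_abs (expR (- j%:R)) y)%:E).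
  apply/measurable_EFinP; apply: measurable_funB => //; exact: measurable_prod_abs.
have onemI j : (expR j%:R * (1 - I j))%:E =
    \int[nu]_y (expR j%:R * (1 - prod_abs (expR (- j%:R)) y))%:E.
  under eq_integral do rewrite EFinM.
  have o0 y : (0 <= 1 - prod_abs (expR (- j%:R)) y)%R.
    by rewrite subr_ge0; case/andP: (prod_abs01 y (u0 j)).
  rewrite ge0_integralZl_EFin//; last by move=> y _; rewrite lee_fin.
  rewrite EFinM; congr (_ * _).
  have : \int[nu]_y (cst 1 y) = \int[nu]_y (1 - prod_abs (expR (- j%:R)) y)%:E +
      \int[nu]_y (prod_abs (expR (- j%:R)) y)%:E.
    rewrite -ge0_integralD//.
    - by apply: eq_integral => y _; rewrite -EFinD subrK.
    - by move=> y _; rewrite lee_fin; exact: o0.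
    - by move=> y _; rewrite lee_fin; case/andP: (prod_abs01 y (u0 j)).
    - by apply/measurable_EFinP; exact: measurable_prod_abs.
  rewrite integral_cst// mul1e nuT -IE.
  by case: (\int[nu]_y _) => [r| |]//; rewrite -EFinD => -[] h; congr EFin; lra.
have -> : (\sum_(j < N) expR j%:R * (1 - I j))%:E + \sum_(j < N) \int[nu]_y excess kappa j y =
  \int[nu]_y \sum_(j < N) ((expR j%:R * (1 - prod_abs (expR (- j%:R)) y))%:E + excess kappa j y).
  rewrite ge0_integral_sum//.
  - rewrite -sumEFin -big_split /=; apply: eq_bigr => j _.
    rewrite onemI -ge0_integralD//; try exact: measurable_excess.
      by move=> y _; rewrite lee_fin.
    by move=> y _; exact: excess_ge0.
  - by move=> j; apply: emeasurable_funD => //; exact: measurable_excess.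
  - by move=> j y _; rewrite adde_ge0 ?excess_ge0// lee_fin.
have G0 : (0 <= \sum_(j < N) slope phi j)%R.
  by apply: sumr_ge0 => j _; exact: slope_ge0.
have c0 : (0 <= c)%R.
  by have := phi_lip ler01; have /andP[] := phi01 ler01; lra.
have mid : measurable_fun [set: seqspace R] (esum_abs id) by exact: measurable_esum_abs.
have mK := measurable_esum_abs (@with_neglog_ge0 R) (@measurable_with_neglog R).
have id0 y : 0 <= esum_abs (@id R) y by exact: esum_abs_ge0.
have K0 y : 0 <= esum_abs (@with_neglog R) y by apply: esum_abs_ge0; exact: with_neglog_ge0.
(* The slopes on the right get coefficient exactly 1 because the mean total mass is 1; their later
   cancellation depends on this. *)
rewrite -[X in X%:E + _]mulr1 EFinM -nu_mass -!ge0_integralZl_EFin//.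
rewrite -ge0_integralD//; try by move=> *; rewrite mule_ge0.
- apply: (@ge0_le_integral_off_null _ _ _ _ (~` nonneg_ultimately_zero R)) => //.
  + by apply: measurableC; exact: measurable_nonneg_ultimately_zero.
  + move=> y; apply: sume_ge0 => j _.
    by rewrite adde_ge0 ?excess_ge0// lee_fin.
  + by move=> y; rewrite adde_ge0// mule_ge0.
  + by move=> y /contrapT; exact: one_step_pointwise.
- exact: measurable_funeM.
- exact: measurable_funeM.
Qed.

End one_step.

(** * Annealed moments *)

Lemma esum_abs_le (R : realType) (F G : R -> R) (y : seqspace R) :
  (forall v : R, (0 <= v)%R -> (0 <= F v)%R) ->
  (forall v : R, (0 <= v)%R -> (F v <= G v)%R) -> esum_abs F y <= esum_abs G y.
Proof.
by move=> F0 FG; apply: lee_nneseries => [i _|i _]; rewrite lee_fin ?F0 ?FG.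
Qed.

Lemma esum_absD (R : realType) (F G : R -> R) (y : seqspace R) :
  (forall v : R, (0 <= v)%R -> (0 <= F v)%R) ->
  (forall v : R, (0 <= v)%R -> (0 <= G v)%R) ->
  esum_abs (fun v => F v + G v)%R y = esum_abs F y + esum_abs G y.
Proof.
move=> F0 G0; rewrite /esum_abs -nneseriesD//=; last 2 first.
- by move=> i _ _; rewrite lee_fin F0.
- by move=> i _ _; rewrite lee_fin G0.
Qed.

Lemma logp_ge0 (R : realType) (v : R) : (0 <= logp v)%R.
Proof. by rewrite le_max lexx. Qed.

Lemma measurable_logp (R : realType) : measurable_fun [set: R] (@logp R).
Proof. exact: measurable_maxr. Qed.

(** The finite sum of [xlnx_le], whose length depends on [y], is bounded by the whole series of
    nonnegative terms. *)
Lemma xlnx_esum_le (R : realType) (kappa : R) (y : seqspace R) :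
  (0 < kappa)%R -> (kappa <= 1)%R -> nonneg_ultimately_zero R y ->
  esum_abs id y * `|lne (esum_abs id y)| <=
  1 + (3 - ln (kappa / 2))%:E * esum_abs id y +
  2%:E * esum_abs (fun v => v * logp v)%R y +
  (2 / kappa)%:E * \sum_(j <oo) excess kappa j y.
Proof.
move=> k0 k1 [y0 [m ym]].
have e (F : R -> R) : F 0%R = 0%R -> esum_abs F y = (\sum_(i < m) F (y i))%R%:E.
  by move=> F0; exact: esum_abs_ultimately_zero.
have z2 j : @truncated R j 0%R = 0%R by rewrite /truncated mul0r.
have ex j : excess kappa j y = (Num.max 0 (kappa *
    (\sum_(i < m) y i * (y i <= expR j%:R)%R%:R) - expR j%:R))%R%:E.
  by rewrite /excess e// -EFinM -EFinB EFin_max.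
have tk : (0 <= 2 / kappa)%R by apply: divr_ge0; lra.
have l0 : (ln (kappa / 2) <= 0)%R by apply: ln_le0; lra.
have S0 : (0 <= \sum_(i < m) y i)%R by apply: sumr_ge0.
have A0 : (0 <= \sum_(i < m) y i * logp (y i))%R.
  by apply: sumr_ge0 => i _; rewrite mulr_ge0// logp_ge0.
have X0 : 0 <= \sum_(j <oo) excess kappa j y.
  by apply: nneseries_ge0 => j _ _; exact: excess_ge0.
rewrite !e//; last by rewrite mul0r.
(* For mass 0 the left side is 0 whatever the logarithm, as 0 times any extended real is 0. *)
have [S1|S1] := eqVneq (\sum_(i < m) y i)%R 0%R.
  rewrite S1 mul0e mule0 adde0 -EFinM -EFinD adde_ge0//.
    by rewrite lee_fin; lra.
  by rewrite mule_ge0.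
have Sp : (0 < \sum_(i < m) y i)%R by rewrite lt_neqAle eq_sym S1.
have [M hM] := xlnx_le y0 k0 k1 Sp.
rewrite lne_EFin// abse_EFin -!EFinM -!EFinD.
apply: (@le_trans _ _ (1 + (3 - ln (kappa / 2)) * (\sum_(i < m) y i) +
   2 * (\sum_(i < m) y i * logp (y i)) +
    2 / kappa * \sum_(j < M)
      Num.max 0 (kappa * (\sum_(i < m) y i * (y i <= expR j%:R)%R%:R) - expR j%:R))%R%:E).
  by rewrite lee_fin.
rewrite [leLHS]EFinD; apply: leeD2l; rewrite EFinM; apply: lee_wpmul2l => //; rewrite -sumEFin.
under eq_bigr do rewrite -ex.
rewrite -(big_mkord xpredT (fun j => excess kappa j y)).
by apply: nneseries_lim_ge => j _ _; exact: excess_ge0.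
Qed.

Section moments.
Context d d' (Theta : measurableType d) (W : measurableType d') (R : realType).
Variables (tau : probability (seqspace Theta) R)
  (P : R.-pker (seqspace Theta) ~> W)
  (Y : nat -> {mfun (seqspace Theta * W)%type >-> seqspace R})
  (eta : R.-pker Theta ~> seqspace R).
Hypothesis heta : forall theta, eta theta (nonneg_ultimately_zero R) = 1.
Hypothesis hY : quenched_law P Y eta.

Let mN : measurable (Y 0%N @^-1` (~` nonneg_ultimately_zero R)).
Proof.
rewrite -[X in measurable X]setTI; apply: (@measurable_funPT _ _ _ _ (Y 0%N)) => //.
by apply: measurableC; exact: measurable_nonneg_ultimately_zero.
Qed.

Lemma eq_integral_annealed (f g : seqspace R -> \bar R) :
  (forall y, nonneg_ultimately_zero R y -> f y = g y) ->
  \int[annealed tau P]_z f (Y 0%N z) = \int[annealed tau P]_z g (Y 0%N z).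
Proof.
move=> fg; apply: (eq_integral_off_null mN); first exact: annealed_nuzC heta hY.
by move=> z /contrapT; exact: fg.
Qed.

Lemma ge0_le_integral_annealed (f g : seqspace R -> \bar R) :
  (forall y, 0 <= f y) -> (forall y, 0 <= g y) ->
  (forall y, nonneg_ultimately_zero R y -> f y <= g y) ->
  \int[annealed tau P]_z f (Y 0%N z) <= \int[annealed tau P]_z g (Y 0%N z).
Proof.
move=> f0 g0 fg; apply: (ge0_le_integral_off_null mN) => //.
  exact: annealed_nuzC heta hY.
by move=> z /contrapT; exact: fg.
Qed.

Lemma quenched_total_mass xi :
  \int[P xi]_w total_mass Y 0 (xi, w) = \int[eta (xi 0%N)]_y esum_abs id y.
Proof.
rewrite -(integral_quenched hY); last 2 first.
- exact: measurable_esum_abs.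
- by move=> y; exact: esum_abs_ge0.
apply: (@eq_integral_off_null _ _ _ _ [set w | (~` nonneg_ultimately_zero R) (Y 0%N (xi, w))]).
- exact: measurable_quenched_nuzC.
- exact: quenched_nuzC heta hY _.
- move=> w /contrapT -[y0 _]; apply: eq_eseriesr => i _.
  by rewrite ger0_norm.
Qed.

Hypothesis mass1 : {ae tau, forall xi, \int[P xi]_w total_mass Y 0 (xi, w) = 1}.

Lemma annealed_mass : \int[annealed tau P]_z esum_abs id (Y 0%N z) = 1.
Proof.
have m1 : measurable_fun setT (@esum_abs R id) by exact: measurable_esum_abs.
have p1 y : 0 <= esum_abs (@id R) y by exact: esum_abs_ge0.
rewrite (integral_annealed tau hY)//.
rewrite (ae_eq_integral (cst 1))//.
- by rewrite integral_cst// mul1e; exact: probability_setT.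
- exact: (measurableT_comp (measurable_fun_integral_kernel (measurable_kernel eta) p1 m1)
    (@measurable_coord _ Theta 0%N)).
- by apply: filterS mass1 => xi + _; rewrite quenched_total_mass.
Qed.

Hypotheses (hlogp : \int[annealed tau P]_z
       \sum_(i <oo) (Y 0%N z i * logp (Y 0%N z i) ^+ 2)%:E < +oo)
    (hlog_fin : -oo < \int[annealed tau P]_z
       \sum_(i <oo) (Y 0%N z i * ln (Y 0%N z i))%:E).

Let vlogp_ge0 (v : R) : (0 <= v)%R -> (0 <= v * logp v)%R.
Proof. by move=> v0; rewrite mulr_ge0// logp_ge0. Qed.

Let mvlogp : measurable_fun [set: R] (fun v : R => v * logp v)%R.
Proof. by apply: measurable_funM => //; exact: measurable_logp. Qed.

Let vneglog_ge0 (v : R) : (0 <= v)%R -> (0 <= v * neglog v)%R.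
Proof. by move=> v0; rewrite mulr_ge0// neglog_ge0. Qed.

Let mvneglog : measurable_fun [set: R] (fun v : R => v * neglog v)%R.
Proof. by apply: measurable_funM => //; exact: measurable_neglog. Qed.

Let mYf (f : seqspace R -> \bar R) : measurable_fun setT f ->
  measurable_fun setT (fun z => f (Y 0%N z)).
Proof. by move=> mf; exact: measurableT_comp. Qed.

(** With [l = logp v], nonnegativity of [v (l - 1)^2] and of [v l] gives [v l <= v + v l^2]; the
    first term has annealed sum 1, the second is finite by [hlogp]. *)
Lemma annealed_xlogp_lty :
  \int[annealed tau P]_z esum_abs (fun v => v * logp v)%R (Y 0%N z) < +oo.
Proof.
pose F2 (v : R) := (v * logp v ^+ 2)%R.
have F20 v : (0 <= v)%R -> (0 <= F2 v)%R by move=> v0; rewrite mulr_ge0// sqr_ge0.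
have mF2 : measurable_fun [set: R] F2.
  by apply: measurable_funM => //; apply: measurable_funX; exact: measurable_logp.
apply: (@le_lt_trans _ _ (\int[annealed tau P]_z (esum_abs id (Y 0%N z) + esum_abs F2 (Y 0%N z)))).
  apply: (@ge0_le_integral_annealed (esum_abs (fun v => v * logp v)%R)
    (fun y => esum_abs id y + esum_abs F2 y)).
  - by move=> y; exact: esum_abs_ge0.
  - by move=> y; apply: adde_ge0; exact: esum_abs_ge0.
  - move=> y _; rewrite -esum_absD//; apply: esum_abs_le => // v v0.
    rewrite /F2 /=; have := mulr_ge0 v0 (logp_ge0 v).
    by have := mulr_ge0 v0 (sqr_ge0 (logp v - 1)%R); lra.
rewrite ge0_integralD//; last 4 first.
- by move=> z _; exact: esum_abs_ge0.
- by apply: (mYf (f := esum_abs id)); exact: measurable_esum_abs.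
- by move=> z _; exact: esum_abs_ge0.
- by apply: (mYf (f := esum_abs F2)); exact: measurable_esum_abs.
rewrite annealed_mass lte_add_pinfty ?ltry//.
rewrite (eq_integral_annealed (g := fun y => \sum_(i <oo) (y i * logp (y i) ^+ 2)%:E))//.
by move=> y [y0 _]; apply: eq_eseriesr => i _; rewrite /F2 ger0_norm.
Qed.

(** The sum of [y_i ln y_i] is [lp - ng], so its negative part is [g] and [ng <= g + lp]. Finiteness
    of [g] comes from [hlog_fin], that of [lp] from the preceding lemma. *)
Lemma annealed_xneglog_lty :
  \int[annealed tau P]_z esum_abs (fun v => v * neglog v)%R (Y 0%N z) < +oo.
Proof.
pose lp := esum_abs (fun v : R => v * logp v)%R.
pose ng := esum_abs (fun v : R => v * neglog v)%R.
pose g (y : seqspace R) := maxe 0 (ng y - lp y).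
pose f (y : seqspace R) : \bar R := \sum_(i <oo) (y i * ln (y i))%:E.
have mlp : measurable_fun setT lp by exact: measurable_esum_abs.
have mng : measurable_fun setT ng by exact: measurable_esum_abs.
have lp0 y : 0 <= lp y by exact: esum_abs_ge0.
have ng0 y : 0 <= ng y by exact: esum_abs_ge0.
have mg : measurable_fun setT g by apply: measurable_maxe => //; exact: emeasurable_funB.
have g0 y : 0 <= g y by rewrite le_max lexx.
have key y : nonneg_ultimately_zero R y -> f^\- y = g y /\ ng y <= g y + lp y.
  move=> [y0 [m ym]].
  have e (F : R -> R) : F 0%R = 0%R -> esum_abs F y = (\sum_(i < m) F (y i))%R%:E.
    by move=> F0; exact: esum_abs_ultimately_zero.
  have fE : f y = (\sum_(i < m) y i * logp (y i) - \sum_(i < m) y i * neglog (y i))%R%:E.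
    rewrite /f (@nneseries_ultimately_zero _ _ m); last by move=> i /ym ->; rewrite mul0r.
    congr EFin; rewrite -sumrB; apply: eq_bigr => i _; rewrite -mulrBr; congr (_ * _)%R.
    rewrite /logp /neglog; case: (lerP 0 (ln (y i))) => h.
      by rewrite max_l ?oppr_le0// subr0.
    by rewrite max_r ?oppr_ge0 ?(ltW h)// sub0r opprK.
  rewrite /g /ng /lp !e ?mul0r// -EFinB; split.
    by rewrite funenegE fE -EFinN opprB maxC.
  rewrite -EFin_max -EFinD lee_fin.
  set a := (\sum_(i < m) _)%R; set b := (\sum_(i < m) _)%R.
  have : (a - b <= Num.max 0 (a - b))%R by rewrite le_max lexx orbT.
  lra.
apply: (@le_lt_trans _ _ (\int[annealed tau P]_z (g (Y 0%N z) + lp (Y 0%N z)))).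
  apply: (@ge0_le_integral_annealed ng (fun y => g y + lp y)) => //.
  - by move=> y; apply: adde_ge0.
  - by move=> y /key[].
rewrite ge0_integralD//; last 2 first.
- exact: (mYf mg).
- exact: (mYf mlp).
rewrite lte_add_pinfty ?annealed_xlogp_lty//.
rewrite -(eq_integral_annealed (f := f^\-)); last by move=> y /key[].
(* Subtracting [+oo] gives [-oo] whatever the positive part is, so an infinite negative part
   contradicts [hlog_fin]. *)
rewrite ltey; apply/eqP => h.
move: hlog_fin; rewrite integralE.
have -> : \int[annealed tau P]_z (fun z => \sum_(i <oo) (Y 0%N z i * ln (Y 0%N z i))%:E)^\- z = +oo.
  by rewrite -h; apply: eq_integral => z _; rewrite !funenegE.
by rewrite addeC addNye.
Qed.

End moments.

(** * The telescoped bound *)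

Section kernel_integral.
Context d (X : measurableType d) (R : realType) (mu : R.-pker X ~> R).

Lemma measurable_kernel_integral (D : set R) (f : R -> \bar R) :
  measurable D -> measurable_fun D f -> (forall x, D x -> 0 <= f x) ->
  measurable_fun setT (fun xi => \int[mu xi]_(x in D) f x).
Proof.
move=> mD mf f0.
under eq_fun do rewrite integral_mkcond.
apply: measurable_fun_integral_kernel.
- exact: measurable_kernel.
- by move=> x; rewrite patchE; case: ifPn => // /set_mem; exact: f0.
- exact/(measurable_restrictT _ mD).
Qed.

End kernel_integral.

Section no_solution.
Context d d' (Theta : measurableType d) (W : measurableType d') (R : realType).
Variables (tau : probability (seqspace Theta) R)
  (P : R.-pker (seqspace Theta) ~> W)
  (Y : nat -> {mfun (seqspace Theta * W)%type >-> seqspace R})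
  (eta : R.-pker Theta ~> seqspace R).
Hypothesis htau : iid tau.
Hypothesis heta : forall theta, eta theta (nonneg_ultimately_zero R) = 1.
Hypothesis hY : quenched_law P Y eta.
Hypothesis mass1 : {ae tau, forall xi, \int[P xi]_w total_mass Y 0 (xi, w) = 1}.
Variables (phi : seqspace Theta -> R -> R) (mu : R.-pker (seqspace Theta) ~> R).
Let I : set R := `[0%R, +oo[%classic.
Hypotheses (mu1 : forall xi, mu xi I = 1)
  (mean1 : \int[tau]_xi \int[mu xi]_(x in I) x%:E = 1)
  (phiE : forall xi (u : R), (0 <= u)%R ->
    (phi xi u)%:E = \int[mu xi]_(x in I) (expR (- (u * x)))%:E)
  (FE : functional_equation tau P Y phi).

Let mean xi := \int[mu xi]_(x in I) x%:E.

Let mI : measurable I. Proof. exact: measurable_itv. Qed.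
Let I0 x : I x -> (0 <= x)%R. Proof. by rewrite /I /= in_itv /= andbT. Qed.

Lemma measurable_mean : measurable_fun setT mean.
Proof.
exact: measurable_kernel_integral.
Qed.

Lemma mean_ge0 xi : 0 <= mean xi.
Proof. by apply: integral_ge0 => x /I0; rewrite lee_fin. Qed.

Lemma measurable_phi (u : R) : (0 <= u)%R -> measurable_fun setT (phi ^~ u).
Proof.
move=> u0; apply/measurable_EFinP.
rewrite (_ : EFin \o _ = fun xi => \int[mu xi]_(x in I) (expR (- (u * x)))%:E).
  apply: measurable_kernel_integral => //.
  apply/measurable_EFinP; apply: measurable_funTS.
  by apply: measurableT_comp => //; apply: measurableT_comp.
by apply/funext => xi /=; rewrite phiE.
Qed.

Lemma measurable_onem_phi_ge (kappa : R) :
  measurable [set xi | (kappa <= 1 - phi xi 1)%R].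
Proof.
have mf : measurable_fun setT (fun xi => 1 - phi xi 1)%R.
  by apply: measurable_funB => //; exact: measurable_phi.
have := mf measurableT _ (measurable_itv `[kappa, +oo[).
rewrite setTI; congr (measurable _); apply/seteqP; split => xi /=;
  by rewrite in_itv /= andbT.
Qed.

(** By stationarity the shifted mean has integral 1. Its finiteness provides a real constant [c] for
    the one-step bound. *)
Lemma mean_shift_lty : {ae tau, forall xi, mean (env_shift xi) < +oo}.
Proof.
have ms := measurableT_comp measurable_mean (@measurable_env_shift _ Theta).
have : tau.-integrable setT (mean \o @env_shift _ Theta).
  apply/integrableP; split => //.
  under eq_integral do rewrite gee0_abs ?mean_ge0//.
  by rewrite (integral_env_shift htau measurable_mean mean_ge0) mean1 ltry.
move=> /integrable_ae => /(_ measurableT).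
by apply: filterS => xi /(_ Logic.I); rewrite ge0_fin_numE ?mean_ge0.
Qed.

(** If [1 - phi xi 1] vanished almost surely, [laplace_eq1] would make the mean vanish almost
    surely, against [mean1]. *)
Lemma exists_kappa : exists kappa : R, [/\ (0 < kappa)%R, (kappa <= 1)%R &
  0 < tau [set xi | (kappa <= 1 - phi xi 1)%R]].
Proof.
pose f xi := (1 - phi xi 1)%R.
have p01 xi := laplace01 (mu1 xi) (phiE xi) ler01.
have f0 xi : (0 <= f xi)%R by rewrite /f; have := p01 xi; lra.
have mf : measurable_fun setT f.
  by apply: measurable_funB => //; exact: measurable_phi.
have fle1 : \int[tau]_xi (f xi)%:E <= 1.
  apply: (@le_trans _ _ (\int[tau]_xi (cst 1 xi))).
    apply: ge0_le_integral => //.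
    - by move=> xi _; rewrite lee_fin.
    - exact/measurable_EFinP.
    - by move=> xi _; rewrite lee_fin /f; have := p01 xi; lra.
  by rewrite integral_cst// mul1e probability_le1.
have fpos : 0 < \int[tau]_xi (f xi)%:E.
  rewrite lt_neqAle integral_ge0 ?andbT; last by move=> xi _; rewrite lee_fin.
  apply/eqP => h.
  have ae0 : ae_eq tau setT (EFin \o f) (cst 0).
    apply/ae_eq_integral_abs => //; first exact/measurable_EFinP.
    rewrite [RHS]h; apply: eq_integral => xi _ /=.
    by rewrite ger0_norm.
  have : \int[tau]_xi mean xi = 0.
    rewrite (ae_eq_integral (cst 0)) ?integral0//; first exact: measurable_mean.
    apply: filterS ae0 => xi /(_ Logic.I) /= -[] e _.
    apply: (laplace_eq1 (mu1 xi) (phiE xi)); move: e; rewrite /f; lra.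
  by rewrite mean1 => -[] /eqP; rewrite oner_eq0.
have ffin : \int[tau]_xi (f xi)%:E \is a fin_num.
  by rewrite ge0_fin_numE ?(ltW fpos)// (le_lt_trans fle1)// ltry.
pose delta := fine (\int[tau]_xi (f xi)%:E).
have dE : delta%:E = \int[tau]_xi (f xi)%:E by rewrite fineK.
have d0 : (0 < delta)%R by rewrite -lte_fin dE.
have d1 : (delta <= 1)%R by rewrite -lee_fin dE.
(* Half of the integral [delta] works: if [1 - phi xi 1 < delta / 2] held almost surely, the
   integral would be at most [delta / 2]. *)
exists (delta / 2)%R; split; [lra|lra|].
pose B := [set xi | (delta / 2 <= 1 - phi xi 1)%R].
have mB : measurable B by exact: measurable_onem_phi_ge.
rewrite lt_neqAle measure_ge0 andbT; apply/eqP => /esym tB.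
suff : (delta%:E <= (delta / 2)%:E)%E by rewrite lee_fin; lra.
rewrite dE.
apply: (@le_trans _ _ (\int[tau]_xi (cst (delta / 2)%:E xi))); last first.
  by rewrite integral_cst// [X in _ * X](_ : _ = 1) ?mule1//; exact: probability_setT.
apply: (ge0_le_integral_off_null mB tB) => xi.
- by rewrite lee_fin.
- by rewrite lee_fin; lra.
- by move=> /negP; rewrite -ltNge lee_fin /f => /ltW.
Qed.

Let slopes (N : nat) xi : R := (\sum_(j < N) slope (phi xi) j)%R.

Let head_integral (f : seqspace R -> \bar R) (theta : Theta) := \int[eta theta]_y f y.

Let eta_setT theta : eta theta setT = 1. Proof. exact: prob_kernel. Qed.

(** Apart from the slopes, every term is a function of [xi 0] times a function of the shift, ready
    for independence. *)
Lemma quenched_bound (kappa : R) (N : nat) : (0 <= kappa)%R ->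
  {ae tau, forall xi, (slopes N xi)%:E +
     (\sum_(j < N) head_integral (excess kappa j) (xi 0%N)) *
        (\1_[set zeta | (kappa <= 1 - phi zeta 1)%R] (env_shift xi))%:E <=
     (slopes N (env_shift xi))%:E +
     head_integral (esum_abs (@with_neglog R)) (xi 0%N) * mean (env_shift xi)}.
Proof.
move=> k0.
(* The exceptional null set of the functional equation depends on [u]; the countably many values
   [e^-j] share one. *)
have FEn : {ae tau, forall xi (j : nat), (phi xi (expR (- j%:R)))%:E =
    \int[P xi]_w (limn (fun m => \prod_(i < m)
      phi (env_shift xi) (expR (- j%:R) * Y 0%N (xi, w) i)))%:E}.
  by apply: ae_foralln => j; apply: FE; exact: expR_ge0.
apply: filterS3 mass1 mean_shift_lty FEn => xi mass fin eqn.
set zeta := env_shift xi in fin eqn *.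
have mz := mu1 zeta; have pz := phiE zeta.
have mfin : mean zeta \is a fin_num by rewrite ge0_fin_numE ?mean_ge0.
have lip (v : R) : (0 <= v)%R -> (1 - phi zeta v <= v * fine (mean zeta))%R.
  by move=> v0; rewrite -lee_fin EFinM fineK//; exact: laplace_lip.
have lni v w := @laplace_nonincreasing R (mu zeta) (phi zeta) pz v w.
have l01 := laplace01 mz pz.
have lc := laplace_concave mz pz.
have l0 := laplace0 mz pz.
have IE (j : nat) : (phi xi (expR (- j%:R)))%:E =
    \int[eta (xi 0%N)]_y (prod_abs (phi zeta) (expR (- j%:R)) y)%:E.
  have u0 := expR_ge0 (- j%:R : R).
  rewrite eqn -(integral_quenched hY); last 2 first.
  - by apply/measurable_EFinP; exact: measurable_prod_abs.
  - by move=> y; rewrite lee_fin; case/andP: (prod_abs01 l01 y u0).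
  apply: (@eq_integral_off_null _ _ _ _ [set w | (~` nonneg_ultimately_zero R) (Y 0%N (xi, w))]).
  - exact: measurable_quenched_nuzC.
  - exact: quenched_nuzC heta hY _.
  - move=> w /contrapT -[y0 _]; rewrite /prod_abs; congr (limn _)%:E.
    apply/funext => m; apply: eq_bigr => i _.
    by rewrite ger0_norm.
have mass' : \int[eta (xi 0%N)]_y esum_abs id y = 1.
  by rewrite -(quenched_total_mass heta hY).
have main (k : R) : (0 <= k)%R -> (k <= 1 - phi zeta 1)%R ->
    (slopes N xi)%:E + \sum_(j < N) head_integral (excess k j) (xi 0%N) <=
    (slopes N zeta)%:E + head_integral (esum_abs (@with_neglog R)) (xi 0%N) * mean zeta.
  move=> k0' k1.
  have := @one_step_integral R (eta (xi 0%N)) (eta_setT _) (eta_nuzC heta _) mass'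
    (phi zeta) (fine (mean zeta)) l0 l01 lc lni lip k N (fun j => phi xi (expR (- j%:R))) k0' k1 IE.
  by rewrite fineK// [X in _ <= _ + X]muleC.
have [kz|kz] := boolP (kappa <= 1 - phi zeta 1)%R.
  by rewrite indicE mem_set// mule1; exact: main.
(* Off the event the one-step bound is used with [kappa = 0] and its nonnegative excess is
   dropped. *)
rewrite indicE memNset ?mule0 ?adde0; last by apply/negP.
have k1 : (0 <= 1 - phi zeta 1)%R by have := l01 _ ler01; lra.
apply: le_trans (main _ (lexx 0%R) k1).
rewrite leeDl// sume_ge0// => j _.
by apply: integral_ge0 => y _; exact: excess_ge0.
Qed.

Let measurable_head (f : seqspace R -> \bar R) : measurable_fun setT f ->
  (forall y, 0 <= f y) -> measurable_fun setT (head_integral f).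
Proof.
move=> mf f0; apply: measurable_fun_integral_kernel => //; exact: measurable_kernel.
Qed.

(** Integration of [quenched_bound]: independence factors the products, the mean integrates to 1,
    and the slopes at [xi] and at its shift have equal integrals. The bound obtained is uniform in
    [N]. *)
Lemma annealed_bound (kappa : R) (N : nat) : (0 <= kappa)%R ->
  (\sum_(j < N) \int[annealed tau P]_z excess kappa j (Y 0%N z)) *
    tau [set zeta | (kappa <= 1 - phi zeta 1)%R] <=
  \int[annealed tau P]_z esum_abs (@with_neglog R) (Y 0%N z).
Proof.
move=> k0; set B := [set zeta | _].
have mB : measurable B by exact: measurable_onem_phi_ge.
have mKn := measurable_esum_abs (@with_neglog_ge0 R) (@measurable_with_neglog R).
have K0 y : 0 <= esum_abs (@with_neglog R) y by apply: esum_abs_ge0; exact: with_neglog_ge0.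
pose H theta := \sum_(j < N) head_integral (excess kappa j) theta.
pose K theta := head_integral (esum_abs (@with_neglog R)) theta.
have he0 j theta : 0 <= head_integral (excess kappa j) theta.
  by apply: integral_ge0 => y _; exact: excess_ge0.
have mhe j : measurable_fun setT (head_integral (excess kappa j)).
  by apply: measurable_head => [|y]; [exact: measurable_excess|exact: excess_ge0].
have mH : measurable_fun setT H by exact: emeasurable_sum.
have H0 theta : 0 <= H theta by apply: sume_ge0.
have mK : measurable_fun setT K by exact: measurable_head.
have Kt0 theta : 0 <= K theta by exact: integral_ge0.
(* The crude bound [e^j] makes the integral of the slopes finite, which permits cancelling it. *)
have s01 xi j : (0 <= slope (phi xi) j <= expR j%:R)%R.
  have := laplace01 (mu1 xi) (phiE xi) (expR_ge0 (- j%:R)) => /andP[a b].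
  have := expR_ge0 (j%:R : R); rewrite /slope => e0; apply/andP; split.
    by rewrite mulr_ge0// subr_ge0.
  by rewrite ler_piMr//; lra.
have mS : measurable_fun setT (fun xi => (slopes N xi)%:E).
  apply/measurable_EFinP; apply: measurable_sum => j.
  apply: measurable_funM => //; apply: measurable_funB => //.
  by apply: measurable_phi; exact: expR_ge0.
have S0 xi : 0 <= (slopes N xi)%:E.
  by rewrite lee_fin; apply: sumr_ge0 => j _; case/andP: (s01 xi j).
have Sfin : \int[tau]_xi (slopes N xi)%:E \is a fin_num.
  rewrite ge0_fin_numE ?integral_ge0//.
  apply: (@le_lt_trans _ _ (\int[tau]_xi (cst (\sum_(j < N) expR j%:R)%R%:E xi))).
    apply: ge0_le_integral => //.
    by move=> xi _; rewrite lee_fin; apply: ler_sum => j _; case/andP: (s01 xi j).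
  by rewrite integral_cst// [X in _ * X](_ : _ = 1) ?mule1 ?ltry//; exact: probability_setT.
have mc0 : measurable_fun setT (fun xi : seqspace Theta => xi 0%N) := @measurable_coord _ Theta 0%N.
have msh := @measurable_env_shift _ Theta.
have mIB : measurable_fun setT (fun zeta => (\1_B zeta)%:E : \bar R).
  by apply/measurable_EFinP; exact: measurable_indic.
have IB0 zeta : 0 <= (\1_B zeta)%:E :> \bar R by rewrite lee_fin indicE ler0n.
have e1 : \int[tau]_xi (H (xi 0%N) * (\1_B (env_shift xi))%:E) =
    (\sum_(j < N) \int[annealed tau P]_z excess kappa j (Y 0%N z)) * tau B.
  rewrite (integral_iid_head_shift htau mH H0 mIB IB0); congr (_ * _); last first.
    by rewrite integral_indic// setIT.
  rewrite ge0_integral_sum//; last first.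
    by move=> j; exact: (measurableT_comp (mhe j) mc0).
  apply: eq_bigr => j _; rewrite (integral_annealed tau hY)//.
    exact: measurable_excess.
  by move=> y; exact: excess_ge0.
have e2 : \int[tau]_xi (K (xi 0%N) * mean (env_shift xi)) =
    \int[annealed tau P]_z esum_abs (@with_neglog R) (Y 0%N z).
  rewrite (integral_iid_head_shift htau mK Kt0 measurable_mean mean_ge0) mean1 mule1.
  by rewrite (integral_annealed tau hY).
have mHB : measurable_fun setT (fun xi : seqspace Theta => H (xi 0%N) * (\1_B (env_shift xi))%:E).
  apply: emeasurable_funM; [exact: measurableT_comp mH mc0|exact: measurableT_comp mIB msh].
have mKM : measurable_fun setT (fun xi : seqspace Theta => K (xi 0%N) * mean (env_shift xi)).
  apply: emeasurable_funM; [exact: measurableT_comp mK mc0|].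
  exact: measurableT_comp measurable_mean msh.
have HB0 (xi : seqspace Theta) : 0 <= H (xi 0%N) * (\1_B (env_shift xi))%:E by rewrite mule_ge0.
have KM0 (xi : seqspace Theta) : 0 <= K (xi 0%N) * mean (env_shift xi) by rewrite mule_ge0// mean_ge0.
have mSs := measurableT_comp mS msh.
rewrite -e1 -e2 -(@leeD2lE _ (\int[tau]_xi (slopes N xi)%:E))//.
rewrite -ge0_integralD//.
rewrite -[X in _ <= X + _](integral_env_shift htau mS S0) -ge0_integralD//.
apply: ae_ge0_le_integral => //.
- by move=> xi _; rewrite adde_ge0.
- exact: emeasurable_funD.
- by move=> xi _; rewrite adde_ge0//; exact: S0.
- exact: emeasurable_funD.
- by apply: filterS (quenched_bound N k0) => xi h _.
Qed.

End no_solution.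

(** * Finiteness of the annealed mean of [S |log S|] for a hypothetical solution *)

Theorem theorem1p3 (R : realType) (d d' : measure_display)
    (Theta : measurableType d) (W : measurableType d')
    (tau : probability (seqspace Theta) R)
    (eta : R.-pker Theta ~> seqspace R)
    (P : R.-pker (seqspace Theta) ~> W)
    (Y : nat -> {mfun (seqspace Theta * W)%type >-> seqspace R})
    (htau : iid tau)
    (heta : forall theta, eta theta (nonneg_ultimately_zero R) = 1)
    (hY : quenched_law P Y eta)
    (hstanding : standing_assumption tau P Y)
    (hlogp : \int[annealed tau P]_z
       \sum_(i <oo) (Y 0%N z i * logp (Y 0%N z i) ^+ 2)%:E < +oo)
    (hlog_fin : -oo < \int[annealed tau P]_z
       \sum_(i <oo) (Y 0%N z i * ln (Y 0%N z i))%:E)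
    (hlog_neg : \int[annealed tau P]_z
       \sum_(i <oo) (Y 0%N z i * ln (Y 0%N z i))%:E < 0)
    (hxlogx : \int[annealed tau P]_z
       (total_mass Y 0 z * `|lne (total_mass Y 0 z)|) = +oo) :
  ~ exists phi : seqspace Theta -> R -> R,
      class_L tau 1 phi /\ functional_equation tau P Y phi.

Proof.
move=> [phi [[mu [mu1 mean1 phiE]] FE]].
have mass1 : {ae tau, forall xi, \int[P xi]_w total_mass Y 0 (xi, w) = 1}.
  by have [] := hstanding 0%N.
have [kappa [k0 k1 tB]] := exists_kappa mu1 mean1 phiE.
set B := [set xi | _] in tB.
have id0 y : 0 <= esum_abs (@id R) y by exact: esum_abs_ge0.
have mid : measurable_fun setT (@esum_abs R id) by exact: measurable_esum_abs.
pose lp := esum_abs (fun v : R => v * logp v)%R.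
pose ng := esum_abs (fun v : R => v * neglog v)%R.
have ng0' (v : R) : (0 <= v)%R -> (0 <= v * neglog v)%R.
  by move=> v0; rewrite mulr_ge0// neglog_ge0.
have lp0' (v : R) : (0 <= v)%R -> (0 <= v * logp v)%R.
  by move=> v0; rewrite mulr_ge0// logp_ge0.
have mlp : measurable_fun setT lp.
  by apply: measurable_esum_abs => //; apply: measurable_funM => //; exact: measurable_logp.
have mng : measurable_fun setT ng.
  by apply: measurable_esum_abs => //; apply: measurable_funM => //; exact: measurable_neglog.
have lp0 y : 0 <= lp y by exact: esum_abs_ge0.
have ng0 y : 0 <= ng y by exact: esum_abs_ge0.
have mY (f : seqspace R -> \bar R) : measurable_fun setT f ->
  measurable_fun setT (fun z => f (Y 0%N z)) by move=> mf; exact: measurableT_comp.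
have mass := annealed_mass heta hY mass1.
have lpfin := annealed_xlogp_lty heta hY mass1 hlogp.
have ngfin := annealed_xneglog_lty heta hY mass1 hlogp hlog_fin.
have Kfin : \int[annealed tau P]_z esum_abs (@with_neglog R) (Y 0%N z) < +oo.
  rewrite (_ : \int[annealed tau P]_z _ = \int[annealed tau P]_z (esum_abs id (Y 0%N z) + ng (Y 0%N z))).
    rewrite ge0_integralD//; [|exact: (mY _ mid)|exact: (mY _ mng)].
    by rewrite mass lte_add_pinfty ?ltry.
  apply: eq_integral => z _; rewrite -esum_absD//; apply: eq_eseriesr => i _.
  by rewrite /with_neglog mulrDr mulr1.
pose A j := \int[annealed tau P]_z excess kappa j (Y 0%N z).
have A0 j : 0 <= A j by apply: integral_ge0 => z _; exact: excess_ge0.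
pose t := fine (tau B).
have tBfin : tau B \is a fin_num.
  by apply: fin_num_measure; exact: (measurable_onem_phi_ge phiE).
have tE : tau B = t%:E by rewrite fineK.
have t0 : (0 < t)%R by rewrite -lte_fin -tE.
(* The uniform bound is divided by the positive probability [t] of the event and passes to the limit
   in [N]. *)
have Afin : \sum_(j <oo) A j < +oo.
  set Kb := \int[annealed tau P]_z _ in Kfin.
  apply: (@le_lt_trans _ _ (Kb * (t^-1)%:E)); last first.
    by rewrite muleC lte_mul_pinfty// lee_fin invr_ge0 ltW.
  apply: lime_le; first by apply: is_cvg_nneseries.
  near=> N; rewrite big_mkord.
  rewrite lee_pdivlMr//.
  rewrite -tE; apply: (annealed_bound htau heta hY mass1 mu1 mean1 phiE FE).
  exact: ltW.
have sumE : \int[annealed tau P]_z (\sum_(j <oo) excess kappa j (Y 0%N z)) = \sum_(j <oo) A j.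
  rewrite integral_nneseries// => j.
  - exact: (mY _ (measurable_excess kappa j)).
  - by move=> z _; exact: excess_ge0.
pose C : R := (3 - ln (kappa / 2))%R.
have C0 : (0 <= C)%R.
  have : (ln (kappa / 2) <= 0)%R by apply: ln_le0; lra.
  by rewrite /C; lra.
pose ex y := \sum_(j <oo) excess kappa j y.
have ex0 y : 0 <= ex y by apply: nneseries_ge0 => j _ _; exact: excess_ge0.
have mex : measurable_fun setT ex.
  apply: ge0_emeasurable_sum => [j y _ _|j _]; first exact: excess_ge0.
  exact: measurable_excess.
have tk : (0 <= 2 / kappa)%R by apply: divr_ge0; lra.
(* [xlnx_esum_le] is integrated: the four terms are controlled by the total probability, [mass],
   [lpfin] and [Afin]. *)
have : \int[annealed tau P]_z (total_mass Y 0 z * `|lne (total_mass Y 0 z)|) < +oo.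
  rewrite (@eq_integral_annealed _ _ _ _ _ tau P Y eta heta hY
    (fun y => (\sum_(i <oo) (y i)%:E) * `|lne (\sum_(i <oo) (y i)%:E)|)
    (fun y => esum_abs id y * `|lne (esum_abs id y)|)); last first.
    move=> y [y0 _]; suff -> : \sum_(i <oo) (y i)%:E = esum_abs id y by [].
    by apply: eq_eseriesr => i _; rewrite ger0_norm.
  apply: (@le_lt_trans _ _ (\int[annealed tau P]_z (1 + C%:E * esum_abs id (Y 0%N z) +
    2%:E * lp (Y 0%N z) + (2 / kappa)%:E * ex (Y 0%N z)))).
    apply: (@ge0_le_integral_annealed _ _ _ _ _ tau P Y eta heta hY
      (fun y => esum_abs id y * `|lne (esum_abs id y)|)
      (fun y => 1 + C%:E * esum_abs id y + 2%:E * lp y + (2 / kappa)%:E * ex y)).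
    - by move=> y; rewrite mule_ge0.
    - by move=> y; rewrite !adde_ge0// mule_ge0.
    - by move=> y ynuz; exact: xlnx_esum_le.
  have m2 := measurable_funeM C%:E (mY _ mid).
  have m3 := measurable_funeM 2%:E (mY _ mlp).
  have m4 := measurable_funeM (2 / kappa)%:E (mY _ mex).
  have m12 : measurable_fun setT (fun z => 1 + C%:E * esum_abs id (Y 0%N z)).
    exact: emeasurable_funD.
  have m123 : measurable_fun setT
      (fun z => 1 + C%:E * esum_abs id (Y 0%N z) + 2%:E * lp (Y 0%N z)).
    exact: emeasurable_funD.
  have p2 z : 0 <= C%:E * esum_abs id (Y 0%N z) by rewrite mule_ge0.
  have p3 z : 0 <= 2%:E * lp (Y 0%N z) by rewrite mule_ge0.
  have p4 z : 0 <= (2 / kappa)%:E * ex (Y 0%N z) by rewrite mule_ge0.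
  rewrite ge0_integralD//; last by move=> z _; rewrite !adde_ge0.
  rewrite ge0_integralD//; last by move=> z _; rewrite adde_ge0.
  rewrite ge0_integralD//.
  rewrite !ge0_integralZl_EFin//; [|exact: (mY _ mex)|exact: (mY _ mlp)|exact: (mY _ mid)].
  have c1 : \int[annealed tau P]_z 1 = 1 :> \bar R.
    transitivity (\int[annealed tau P]_z (cst 1 z)) => //.
    by rewrite integral_cst// mul1e; exact: probability_setT.
  rewrite c1 mass sumE mule1.
  by rewrite !lte_add_pinfty ?ltry ?lte_mul_pinfty.
by rewrite hxlogx ltxx.
Unshelve. all: by end_near.
Qed.
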